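(* Let $\omega=(\omega_1,\omega_2,\ldots)\in\{0,1\}^{\mathbb{N}}$ be a Martin-Löf random sequence. For $n\ge 1$ define $$X_n=\frac{1}{\sqrt n}\left(2\sum_{i=n(n-1)/2+1}^{n(n+1)/2}\omega_i\;-\;n\right),$$ so that $X_1,X_2,X_3,\ldots$ use consecutive disjoint blocks of $\omega$ of lengths $1,2,3,\ldots$. For $k\ge 1$ let $\widehat D_k$ be the random variable assigning probability $1/k$ to each outcome $X_i$, $i=1,\ldots,k$ (counted with multiplicity), and let $\widehat F_k(t)=\frac1k\,\#\{i\le k: X_i\le t\}$, $t\in\mathbb{R}$, be its cumulative distribution function. Then: 1. For every $m\in\mathbb{N}_0$, $$\mathbb{E}\left[\widehat D_k^m\right]=\frac{X_1^m+X_2^m+\cdots+X_k^m}{k}\longrightarrow \nu_m\qquad\text{as }k\to\infty,$$ where $\nu_m$ is the $m$-th moment of the standard normal distribution. 2. The functions $\widehat F_k$ converge uniformly to the cumulative distribution function $\Phi$ of the standard normal distribution, i.e. $$\sup_{t\in\mathbb{R}}\left|\widehat F_k(t)-\Phi(t)\right|\longrightarrow 0\qquad\text{as }k\to\infty.$$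
   Context: Let $2^{\mathbb{N}}=\{0,1\}^{\mathbb{N}}$ be the Cantor space and, for a finite binary string $x$ of length $|x|$, let $\Omega_x\subset 2^{\mathbb{N}}$ be the cylinder of all infinite sequences with prefix $x$. Let $\lambda$ be the fair coin-tossing (Lebesgue) probability measure on $2^{\mathbb{N}}$, $\lambda(\Omega_x)=2^{-|x|}$. A set $U=\Omega_{x_1}\cup\Omega_{x_2}\cup\cdots$ is effectively open if the set of strings $\{x_1,x_2,\ldots\}$ is recursively enumerable. A sequence $(U_i)_{i\ge1}$ of effectively open sets is uniformly r.e. if there is an algorithm which, on input $i$, enumerates strings whose cylinders have union $U_i$. A Martin-Löf test is a uniformly r.e. sequence $(U_i)_{i\ge1}$ with $\lambda(U_i)\le 2^{-i}$ for all $i$. A sequence $\omega\in 2^{\mathbb{N}}$ is Martin-Löf random if it does not belong to $\bigcap_i U_i$ for any Martin-Löf test $(U_i)$. The moments of the standard normal distribution are $\nu_m=0$ for $m$ odd and $\nu_m=(m-1)!!=(m-1)(m-3)\cdots 3\cdot 1$ for $m$ even (with $(-1)!!=1$). $\mathbb{N}_0$ denotes the nonnegative integers, and $0^0=1$. *)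

(* Defs.v *)
From HB Require Import structures.
From mathcomp Require Import all_boot all_order all_algebra.
From mathcomp Require Import all_classical all_reals all_analysis.
Set Implicit Arguments.
Unset Strict Implicit.
Unset Printing Implicit Defensive.
Import Order.TTheory GRing.Theory Num.Theory.
Import numFieldNormedType.Exports.
Local Open Scope classical_set_scope.
Local Open Scope ring_scope.

(** Kleene's schemes; [recfun n] denotes partial functions from [nat^n] to
    [nat]. *)
Inductive recfun : nat -> Type :=
| Zero : recfun 0
| Succ : recfun 1
| Proj n (i : 'I_n) : recfun n
| Comp n k (f : recfun k) (g : 'I_k -> recfun n) : recfun n
| Prec n (f : recfun n) (g : recfun n.+2) : recfun n.+1
| Mu n (f : recfun n.+1) : recfun n.

(** Primitive recursion on graphs: [y] is the result after [x] steps, with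
    initial value in [F] and step [z |-> G i z]. *)
Fixpoint prec_graph (F : nat -> Prop) (G : nat -> nat -> nat -> Prop)
    (x y : nat) : Prop :=
  if x is i.+1 then exists2 z, prec_graph F G i z & G i z y else F y.

(** [evalr f v y] means that [f] is defined at [v] with value [y].  In the
    schemes [Prec] and [Mu], the recursion (resp. search) variable is the first
    argument; the step function of [Prec] takes the index, the previous value
    and the parameters, in this order.  The search in [Mu] diverges if it meets
    an argument where [f] is undefined. *)
Fixpoint evalr n (f : recfun n) : n.-tuple nat -> nat -> Prop :=
  match f in recfun n return n.-tuple nat -> nat -> Prop with
  | Zero => fun _ y => y = 0%N
  | Succ => fun v y => y = (thead v).+1
  | Proj _ i => fun v y => y = tnth v i
  | Comp _ k f g => fun v y =>
      exists2 w : k.-tuple nat,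
        (forall i, evalr (g i) v (tnth w i)) & evalr f w y
  | Prec _ f g => fun v y =>
      prec_graph (evalr f (behead_tuple v))
        (fun i z => evalr g [tuple of i :: z :: behead_tuple v]) (thead v) y
  | Mu _ f => fun v y =>
      evalr f [tuple of y :: v] 0%N /\
      forall z, (z < y)%N -> exists w, evalr f [tuple of z :: v] w.+1
  end.

Definition cylinder (x : seq bool) : set (nat -> bool) :=
  [set w | mkseq w (size x) = x].

Notation cantor := (g_sigma_algebraType (range cylinder)).

(** [binary_digits t n] is the coefficient of [2 ^- n.+1] in the (greedy) binary
    expansion of [t], for [t] in [[0, 1[]. *)
Definition binary_digits (R : realType) (t : measurableTypeR R) : cantor :=
  fun n => odd `|Num.floor (t * 2 ^+ n.+1)|%N.

Lemma measurable_floor_pred (R : realType) (c : R) (P : pred int) :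
  0 < c -> measurable [set t : measurableTypeR R | P (Num.floor (t * c))].
Proof.
move=> c0.
have -> : [set t : measurableTypeR R | P (Num.floor (t * c))] =
  \bigcup_k (if P k then `[k%:~R / c, (k + 1)%:~R / c[%classic else set0).
  apply/seteqP; split => t /=.
  - move=> Pt; exists (Num.floor (t * c)) => //=; rewrite Pt.
    by rewrite /= in_itv/= ler_pdivrMr// ltr_pdivlMr// floor_itv.
  - move=> [k _]; case: ifP => //= Pk.
    rewrite in_itv/= ler_pdivrMr// ltr_pdivlMr// => tk.
    by rewrite (floor_def tk).
apply: countable_bigcupT_measurable => // k.
by case: ifP => // _; exact: measurable_itv.
Qed.

Lemma measurable_binary_digits (R : realType) :
  measurable_fun setT (@binary_digits R).
Proof.
apply: (@measurability _ _ (measurableTypeR R) cantor setT (@binary_digits R)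
  (range cylinder) erefl).
move=> _ [_ [x _ <-] <-]; rewrite setTI.
have -> : @binary_digits R @^-1` cylinder x =
  \bigcap_(i in [set i | (i < size x)%N])
    [set t : measurableTypeR R | odd `|Num.floor (t * 2 ^+ i.+1)|%N == nth false x i].
  apply/seteqP; split => t /=.
  - by move=> tx i /= ix; rewrite -[in X in _ == X]tx nth_mkseq.
  - move=> tx; apply: (@eq_from_nth _ false); rewrite size_mkseq// => i ix.
    by rewrite nth_mkseq//; exact/eqP/(tx i).
apply: bigcap_measurableType => i _.
exact: (@measurable_floor_pred R (2 ^+ i.+1)
  (fun k : int => odd `|k|%N == nth false x i)).
Qed.

HB.instance Definition _ (R : realType) :=
  isMeasurableFun.Build _ _ _ _ (@binary_digits R) (@measurable_binary_digits R).

(** The image of the uniform probability on [[0, 1]] under the binary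
    expansion; see [fair_coin_cylinder]. *)
Definition fair_coin (R : realType) : probability cantor R :=
  distribution (uniform_prob (@ltr01 R)) (@binary_digits R).

Lemma floor_double (R : realType) (u : R) : 0 <= u ->
  `|Num.floor (u * 2)|%N
  = (`|Num.floor u|.*2 + odd `|Num.floor (u * 2)|)%N.
Proof.
move=> u0; set a := `|Num.floor u|%N; set b := `|Num.floor (u * 2)|%N.
have Ea : Num.floor u = a%:Z by rewrite /a gez0_abs// floor_ge0.
have Eb : Num.floor (u * 2) = b%:Z by rewrite /b gez0_abs// floor_ge0 mulr_ge0.
have /andP[a1 a2] := floor_itv u; rewrite Ea in a1 a2.
have /andP[b1 b2] := floor_itv (u * 2); rewrite Eb in b1 b2.
suff <- : b./2 = a by rewrite addnC odd_double_half.
have a1' : (a%:R : R) <= u by [].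
have a2' : u < (a.+1%:R : R) by rewrite -[a.+1]addn1; exact: a2.
have b1' : (b%:R : R) <= u * 2 by [].
have b2' : u * 2 < (b.+1%:R : R) by rewrite -[b.+1]addn1; exact: b2.
have h1 : (b < a.+1 * 2)%N.
  by rewrite -(ltr_nat R) natrM (le_lt_trans b1')// ltr_pM2r.
have h2 : (a * 2 < b.+1)%N.
  by rewrite -(ltr_nat R) natrM (le_lt_trans _ b2')// ler_pM2r.
apply/eqP; rewrite eqn_leq; apply/andP; split.
  by rewrite -ltnS -divn2 ltn_divLR.
by rewrite -divn2 leq_divRL.
Qed.

Lemma floor_binary_digits (R : realType) (t : R) (n : nat) : 0 <= t < 1 ->
  `|Num.floor (t * 2 ^+ n)|%N
  = foldl (fun (m : nat) (b : bool) => m.*2 + b)%N 0%N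
      (mkseq (binary_digits t) n).
Proof.
move=> /andP[t0 t1]; elim: n => [|n IHn].
  by rewrite expr0 mulr1 (@floor_def _ t 0)// t0.
rewrite mkseqS -cats1 foldl_cat /= -IHn exprSr mulrA floor_double.
  by rewrite /binary_digits exprSr mulrA.
by rewrite mulr_ge0 ?exprn_ge0.
Qed.

Lemma foldl_bits_inj (x y : seq bool) : size x = size y ->
  foldl (fun (m : nat) (b : bool) => m.*2 + b)%N 0%N x
  = foldl (fun (m : nat) (b : bool) => m.*2 + b)%N 0%N y -> x = y.
Proof.
elim/last_ind: x y => [|x a IHx] y; elim/last_ind: y => [|y b _] //.
- by rewrite size_rcons.
- by rewrite size_rcons.
rewrite !size_rcons => -[sxy]; rewrite -!cats1 !foldl_cat /= => E.
have Eab : a = b.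
  by have := congr1 odd E; rewrite !oddD !odd_double !oddb.
by move: E; rewrite Eab => /addIn/double_inj/(IHx _ sxy) ->.
Qed.

Lemma foldl_bits_lt (x : seq bool) :
  (foldl (fun (m : nat) (b : bool) => m.*2 + b) 0 x < 2 ^ size x)%N.
Proof.
elim/last_ind: x => [|x a IHx] //.
rewrite size_rcons -cats1 foldl_cat /= expnS mul2n.
by case: a; rewrite ?addn1 ?addn0 ?ltn_double// ltn_Sdouble.
Qed.

Lemma fair_coin_cylinder (R : realType) (x : seq bool) :
  fair_coin R (cylinder x) = (2^-1 ^+ size x)%:E.
Proof.
rewrite /fair_coin /distribution /= /pushforward /=.
set U := @binary_digits R @^-1` cylinder x.
have mU : measurable U.
  rewrite -[U]setTI; apply: measurable_binary_digits => //.
  by apply: sub_sigma_algebra; exists x.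
set v := foldl (fun (m : nat) (b : bool) => m.*2 + b)%N 0%N x.
set c : R := 2 ^+ size x.
have c0 : 0 < c by rewrite exprn_gt0.
pose I : set R := `[v%:R / c, v.+1%:R / c[%classic.
have UI (t : R) : 0 <= t < 1 -> U t <-> I t.
  move=> t01; have /andP[t0 t1] := t01.
  rewrite /I /= in_itv /= ler_pdivrMr// ltr_pdivlMr//; split.
  - move=> tx; have := floor_binary_digits (size x) t01.
    rewrite tx -/v -/c => vE.
    have := floor_itv (t * c).
    have : 0 <= Num.floor (t * c) by rewrite floor_ge0 mulr_ge0// ltW.
    by move/gez0_abs; rewrite vE => <-; rewrite -[v.+1]addn1.
  - move=> tv; apply: foldl_bits_inj; first by rewrite size_mkseq.
    rewrite -floor_binary_digits// -/c (@floor_def _ _ v%:Z)//.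
    by rewrite -[v%:Z + 1]/(Posz (v + 1)) addn1.
have I01 (t : R) : I t -> 0 <= t < 1.
  rewrite /I /= in_itv /= => /andP[t1 t2].
  rewrite (le_trans _ t1) ?divr_ge0 ?(ltW c0)//= (lt_le_trans t2)//.
  by rewrite ler_pdivrMr// mul1r /c -natrX ler_nat foldl_bits_lt.
have mI : measurable I by exact: measurable_itv.
have lI : lebesgue_measure I = (c^-1)%:E.
  rewrite /I lebesgue_measure_itv /= lte_fin ltr_pM2r ?invr_gt0// ltr_nat leqnn.
  by rewrite -EFinB -mulrBl -natrB// subSnn mul1r.
have -> : uniform_prob (@ltr01 R) U = lebesgue_measure (U `&` `[0, 1]).
  rewrite /uniform_prob integral_uniform_pdf.
  rewrite (eq_integral (cst 1%E)); last first.
    move=> t; rewrite inE => -[_] /=; rewrite in_itv/= /uniform_pdf => ->.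
    by rewrite subr0 invr1.
  by rewrite integral_cst ?mul1e//; exact: measurableI.
rewrite exprVn -/c -lI; apply/eqP; rewrite eq_le; apply/andP; split.
- have -> : lebesgue_measure I = lebesgue_measure (I `|` [set 1]).
    apply/eqP; rewrite eq_le; apply/andP; split.
      by apply: le_measure; rewrite ?inE//; exact: measurableU.
    have := @measureU2 _ _ _ (@lebesgue_measure R) I [set 1] mI
      (@measurable_set1 R 1).
    by rewrite [X in (_ <= _ + X)%E -> _]lebesgue_measure_set1 adde0.
  apply: le_measure; rewrite ?inE//; [exact: measurableI|exact: measurableU|].
  move=> t [Ut] /=; rewrite in_itv/= => /andP[t0].
  by rewrite le_eqVlt => /orP[/eqP ->|t1]; [right|left; apply/UI; rewrite ?t0].
- apply: le_measure; rewrite ?inE//; first exact: measurableI.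
  move=> t It; have /andP[t0 t1] := I01 _ It.
  by split; [apply/UI; rewrite ?t0|rewrite /= in_itv/= t0 ltW].
Qed.

(** The number whose binary digits are, from the least significant one on, those
    of [x], followed by a final [1].  This is injective, with image the positive
    numbers. *)
Definition string_code (x : seq bool) : nat :=
  foldr (fun (b : bool) (m : nat) => m.*2 + b)%N 1%N x.

(** The algorithm may enumerate no string: [evalr e] is a partial function. *)
Definition enumerated (e : recfun 2) (i : nat) : set (seq bool) :=
  [set x | exists n : nat, evalr e [tuple i; n] (string_code x)].

(** The sequences of sets considered below start at index [1]. *)
Definition uniformly_re (U : nat -> set cantor) : Prop :=
  exists e : recfun 2, forall i : nat, (1 <= i)%N ->
    U i = \bigcup_(x in enumerated e i) cylinder x.

Definition martin_lof_test (R : realType) (U : nat -> set cantor) : Prop :=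
  uniformly_re U /\
  forall i : nat, (1 <= i)%N -> (fair_coin R (U i) <= (2^-1 ^+ i)%:E)%E.

Definition martin_lof_random (R : realType) (w : cantor) : Prop :=
  forall U : nat -> set cantor, martin_lof_test R U ->
    ~ (\bigcap_(i in [set i | (1 <= i)%N]) U i) w.

(** [w i.-1] is the [i]-th term of the sequence, counted from [1]. *)
Definition block_sum (R : realType) (w : cantor) (n : nat) : R :=
  (Num.sqrt n%:R)^-1 *
  (2 * (\sum_(((n * (n - 1))./2).+1 <= i < ((n * (n + 1))./2).+1) w i.-1)%N%:R
   - n%:R).

(** The distribution of a random variable with equiprobable outcomes
    [s 1, ..., s k]: the sum of the Dirac masses at these points, normalized.
    For [k = 0] the value is the irrelevant default [\d_0]. *)
Definition empirical (R : realType) (s : nat -> R) (k : nat) :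
    probability (measurableTypeR R) R :=
  mnormalize (msum (fun i => \d_(s i.+1 : measurableTypeR R)) k)
    \d_(0 : measurableTypeR R).

Definition empirical_cdf (R : realType) (s : nat -> R) (k : nat) (t : R) : R :=
  k%:R^-1 * #|[pred i : 'I_k | s i.+1 <= t]|%:R.

Lemma empirical_cdfE (R : realType) (s : nat -> R) (k : nat) (t : R) :
  (0 < k)%N -> empirical s k `]-oo, t]%classic = (empirical_cdf s k t)%:E.
Proof.
move=> k0.
pose mu : {measure set (measurableTypeR R) -> \bar R} :=
  msum (fun i => \d_(s i.+1 : measurableTypeR R)) k.
have E (A : set (measurableTypeR R)) :
    mu A = (\sum_(i < k) (\1_A (s i.+1) : R))%:E by rewrite -sumEFin.
have ET : mu [set: measurableTypeR R] = (k%:R)%:E.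
  rewrite E (eq_bigr (fun=> 1)); last by move=> i _; rewrite indicT.
  by rewrite sumr_const card_ord.
have nE (A : set (measurableTypeR R)) :
    mnormalize mu (\d_(0 : measurableTypeR R)) A = (mu A * (k%:R^-1)%:E)%E.
  by rewrite /mnormalize ET orbF eqe pnatr_eq0 eqn0Ngt k0.
transitivity (mnormalize mu (\d_(0 : measurableTypeR R)) `]-oo, t]%classic) => //.
rewrite nE E -EFinM mulrC; congr (_ * _)%:E; rewrite -sum1_card natr_sum.
rewrite [RHS]big_mkcond; apply: eq_bigr => i _.
rewrite indicE mem_setE /= in_itv /= unfold_in /=.
by case: ifP.
Qed.

Fixpoint double_fact (n : nat) : nat :=
  if n is m.+2 then (n * double_fact m)%N else 1%N.

(** [double_fact m.-1] is [1] for [m = 0], in accordance with [(-1)!! = 1]. *)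
Definition normal_moment (m : nat) : nat :=
  if odd m then 0%N else double_fact m.-1.

Definition normal_cdf (R : realType) (t : R) : R :=
  fine (normal_prob 0 1 `]-oo, t]).

(* Main.v *)
Require Import Defs.
From HB Require Import structures.
From mathcomp Require Import all_boot all_order all_algebra.
From mathcomp Require Import all_classical all_reals all_analysis.
From mathcomp Require Import measurable_realfun.
From mathcomp Require Import ring lra zify.
Import Order.TTheory GRing.Theory Num.Theory.
Import numFieldNormedType.Exports.
Local Open Scope classical_set_scope.
Local Open Scope ring_scope.
Set Implicit Arguments.
Unset Strict Implicit.
Unset Printing Implicit Defensive.

(** Let [T_n] be the position of a fair [+1], [-1] walk after [n] steps. The
    blocks of a random sequence should behave like independent samples of
    [X_n = T_n / sqrt n], and the proof makes this precise for moments first.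

    Expected moments. Discrete integration by parts, [coin_mean_stein], gives
    [E (T_n h(T_n)) = n E ((h(T_(n-1) + 1) - h(T_(n-1) - 1)) / 2)]. For a power
    [h] this expresses the moments of [X_n] through lower ones, and in the limit
    it becomes the recursion [nu_(m+1) = m nu_(m-1)] of the normal moments:
    [E X_n^m] tends to [nu_m], see [cvg_walk_moment].

    Law of large numbers. A sum of [k] independent centered block statistics
    with bounded fourth moments has a fourth moment of order [k^2], by
    [mean_block_sum4], so its average over [k] blocks exceeds a fixed bound with
    probability of order [1 / k^2]. This is summable: the set where it happens
    for some [k >= K 2^i] has measure at most [2^-i]. If the statistics take
    integer values computed by a program, a prefix of the sequence decides each
    of these events, and the sets form a Martin-Lof test; a random sequence
    therefore escapes one of them ([random_block_average]). The power [X_n^m] is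
    irrational in general, but the integer part of [Q |X_n|^m] is obtained by
    integer arithmetic, and large [Q] give the convergence of the averages of
    [X_n^m] to [nu_m] ([random_moment_average]).

    Distribution functions. Convergence of the moments implies convergence of
    the averages of [cos (a x + b)]: the error of the Taylor polynomial of
    degree [2 n - 1] is bounded by the moment of order [2 n] times
    [a^(2 n) / (2 n)!], which tends to [0] for normal moments. The product
    formula for cosines extends this to polynomials in [cos (a x + b)], and
    these approximate steps: with [p = (1 + cos (a x + b)) / 2], the function
    [(1 - p^n)^(2^n)] is close to [1] where [p < 1/2] and to [0] where
    [p > 1/2], by Bernoulli's inequality. Second moments control what happens
    outside a period. So the empirical distribution functions converge at every
    point, and uniformly by monotonicity, the limit being Lipschitz
    ([moment_method]). *)

(** * Computable functions *)

Definition represents k (e : recfun k) (F : seq nat -> nat) : Prop :=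
  forall (v : k.-tuple nat) y, evalr e v y <-> y = F v.

(** Functions read their arguments by position in a list, a missing one being
    [0], and must have a program for every number of arguments: in this form
    they compose without any bookkeeping of arities. *)
Definition computable (F : seq nat -> nat) : Prop :=
  forall k, exists e : recfun k, represents e F.

Lemma represents_comp k n (f : recfun k) (g : 'I_k -> recfun n)
    (F : seq nat -> nat) (G : 'I_k -> seq nat -> nat) :
  represents f F -> (forall i, represents (g i) (G i)) ->
  represents (Comp f g) (fun v => F [tuple G i v | i < k]).
Proof.
move=> hf hg v y; split=> /= [[w hw /hf ->]|->].
  suff -> : w = [tuple G i v | i < k] by [].
  by apply: eq_from_tnth => i; rewrite tnth_mktuple; apply/hg.
exists [tuple G i v | i < k]; last exact/hf.
by move=> i; rewrite tnth_mktuple; apply/hg.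
Qed.

Lemma represents_ext k (e : recfun k) (F G : seq nat -> nat) :
  (forall v : k.-tuple nat, F v = G v) -> represents e F -> represents e G.
Proof. by move=> FG eF v y; rewrite -FG; exact: eF. Qed.

Lemma computable_ext F G : F =1 G -> computable F -> computable G.
Proof. by move=> /funext ->. Qed.

Lemma computable0 : computable (fun=> 0%N).
Proof.
move=> k; exists (Comp Zero (fun i : 'I_0 => False_rect _ (notF (ltn_ord i)))).
apply: represents_ext (represents_comp (F := fun=> 0%N)
  (G := fun _ _ => 0%N) _ _) => //.
by case.
Qed.

Lemma computable_comp1 (f : recfun 1) (phi : nat -> nat) F :
  represents f (fun v => phi (head 0%N v)) ->
  computable F -> computable (fun v => phi (F v)).
Proof.
move=> fphi cF k; have [e eF] := cF k; exists (Comp f (fun=> e)).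
apply: represents_ext (represents_comp fphi (fun=> eF)) => v.
by rewrite /= enum_ordSl.
Qed.

Lemma computableS F : computable F -> computable (fun v => (F v).+1).
Proof.
apply: (computable_comp1 (f := Succ) (phi := S)) => v y.
by rewrite [tval v]/= (tuple_eta v).
Qed.

Lemma computable_const c : computable (fun=> c).
Proof. by elim: c => [|c /computableS//]; exact: computable0. Qed.

Lemma computable_nth i : computable (fun v => nth 0%N v i).
Proof.
move=> k; have [ik|ki] := ltnP i k.
  exists (Proj (Ordinal ik)) => v y /=.
  by rewrite (tnth_nth 0%N).
have [e e0] := computable0 k; exists e.
by apply: represents_ext e0 => v; rewrite nth_default// size_tuple.
Qed.

(** Programs compose with projections only at a known arity, so the length of
    the renamed environment must be a function [d] of that of [v]. *)
Lemma computable_rename F (d r : nat -> nat) : computable F ->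
  computable (fun v => F (mkseq (fun i => nth 0%N v (r i)) (d (size v)))).
Proof.
move=> cF k; have [e eF] := cF (d k).
have /choice[g gr] : forall i : 'I_(d k), exists g : recfun k,
    represents g (fun v => nth 0%N v (r i)).
  by move=> i; exact: computable_nth.
exists (Comp e g); apply: represents_ext (represents_comp eF gr) => v.
congr F; rewrite size_tuple /mkseq -val_enum_ord -map_comp.
by [].
Qed.

Lemma computable_behead F : computable F -> computable (fun v => F (behead v)).
Proof.
move=> /(computable_rename predn S); apply: computable_ext => v.
congr F; apply: (@eq_from_nth _ 0%N); rewrite ?size_mkseq ?size_behead// => i iv.
by rewrite nth_mkseq// nth_behead.
Qed.

(** [Prec] recurses on its first argument; composing it with a program for [B]
    and projections makes the number of iterations a function of [v]. *)
Lemma computable_rec (B F : seq nat -> nat) (G : nat -> nat -> seq nat -> nat) :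
  computable B -> computable F ->
  computable (fun v => G (nth 0%N v 0) (nth 0%N v 1) (behead (behead v))) ->
  computable (fun v => iteri (B v) (fun i z => G i z v) (F v)).
Proof.
move=> cB cF cG k.
have [b bB] := cB k; have [f fF] := cF k; have [g gG] := cG k.+2.
exists (Comp (Prec f g) (fun i => if unlift ord0 i is Some j then Proj j else b)).
pose H := fun v => iteri (head 0%N v)
  (fun i z => G i z (behead v)) (F (behead v)).
have hH : represents (Prec f g) H.
  move=> v y; rewrite /H /=.
  have -> : head 0%N v = thead v by case/tupleP: v.
  rewrite -[behead v]/(tval (behead_tuple v)).
  move: (thead v) (behead_tuple v) => n w.
  elim: n y => [|n IHn] y /=; first exact: fF.
  split=> [[z /IHn -> /gG]//|->].
  by eexists; [apply/IHn; reflexivity|apply/gG].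
apply: represents_ext (represents_comp hH
  (G := fun i v => if unlift ord0 i is Some j then nth 0%N v j else B v) _).
  move=> v; rewrite /H /= enum_ordSl /= unlift_none.
  suff -> : [seq (if unlift ord0 i is Some j then nth 0%N v j else B v)
    | i <- map (lift ord0) (enum 'I_k)] = v by [].
  rewrite -map_comp -[RHS](map_tnth_enum v); apply: eq_map => i /=.
  by rewrite liftK (tnth_nth 0%N).
move=> i; case: unliftP => [j _|_] //= v y.
by rewrite /= (tnth_nth 0%N).
Qed.

Lemma computableD F G : computable F -> computable G ->
  computable (fun v => (F v + G v)%N).
Proof.
move=> cF cG; apply: (computable_ext (F := fun v => iteri (F v)
  (fun _ z => z.+1) (G v))) => [v|].
  by elim: (F v) => //= n ->; rewrite addSn.
apply: (computable_rec (G := fun _ z _ => z.+1)) => //.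
by apply: computableS; exact: computable_nth.
Qed.

(** The body of a bounded sum sees the index in front of the parameters; in
    this form the lemma applies by higher-order pattern unification. *)
Lemma computable_sum (B : seq nat -> nat) (G : nat -> seq nat -> nat) :
  computable B -> computable (fun v => G (nth 0%N v 0) (behead v)) ->
  computable (fun v => \sum_(0 <= j < B v) G j v)%N.
Proof.
move=> cB cG; apply: (computable_ext (F := fun v => iteri (B v)
  (fun j z => (z + G j v)%N) 0%N)) => [v|].
  by elim: (B v) => [|n IHn] /=; [rewrite big_geq|rewrite big_nat_recr//= -IHn].
apply: (computable_rec (G := fun j z v => (z + G j v)%N)) => //.
  exact: computable0.
apply: computableD; first exact: computable_nth.
(* The summand must skip the partial sum, which is at position 1. *)
move: cG => /(computable_rename (fun k => maxn 1 k.-1)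
  (fun i => if i is j.+1 then j.+2 else 0%N)).
apply: computable_ext => v /=; rewrite nth_mkseq ?leq_max//.
congr (G _ _); apply: (@eq_from_nth _ 0%N); rewrite !size_behead ?size_mkseq.
  by lia.
by move=> i iv; rewrite !nth_behead nth_mkseq//; lia.
Qed.

Lemma computableM F G : computable F -> computable G ->
  computable (fun v => (F v * G v)%N).
Proof.
move=> cF cG; apply: (computable_ext (F := fun v => \sum_(0 <= j < F v) G v)%N).
  by move=> v; rewrite sum_nat_const_nat subn0.
by apply: computable_sum => //; exact: (computable_behead cG).
Qed.

Lemma computableX F G : computable F -> computable G ->
  computable (fun v => (F v ^ G v)%N).
Proof.
move=> cF cG; apply: (computable_ext (F := fun v => iteri (G v)
  (fun _ z => z * F v)%N 1%N)) => [v|].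
  by elim: (G v) => //= n ->; rewrite expnSr.
apply: (computable_rec (G := fun _ z v => (z * F v)%N)) => //.
  exact: computable_const.
apply: computableM; first exact: computable_nth.
exact: (computable_behead (computable_behead cF)).
Qed.

Lemma computable_pred F : computable F -> computable (fun v => (F v).-1).
Proof.
move=> cF; apply: (computable_ext (F := fun v => iteri (F v)
  (fun i _ => i) 0%N)) => [v|]; first by case: (F v).
apply: (computable_rec (G := fun i _ _ => i)) => //.
  exact: computable0.
exact: computable_nth.
Qed.

Lemma computableB F G : computable F -> computable G ->
  computable (fun v => (F v - G v)%N).
Proof.
move=> cF cG; apply: (computable_ext (F := fun v => iteri (G v)
  (fun _ z => z.-1)%N (F v))) => [v|].
  by elim: (G v) => [|n IHn] /=; rewrite ?subn0// subnS IHn.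
apply: (computable_rec (G := fun _ z v => z.-1)) => //.
by apply: computable_pred; exact: computable_nth.
Qed.

(** Truth values are computed as numbers, through the coercion of [bool] to
    [nat]. *)
Lemma computable_leq F G : computable F -> computable G ->
  computable (fun v => (F v <= G v)%N : nat).
Proof.
move=> cF cG; apply: (computable_ext (F := fun v => 1 - (F v - G v))%N).
  move=> v; rewrite -subn_eq0.
  by case: (F v - G v)%N => [|n]; rewrite ?subn0// subSS sub0n.
by apply: computableB; [exact: computable_const|exact: computableB].
Qed.

Lemma computable_and (P Q : seq nat -> bool) :
  computable (fun v => P v : nat) -> computable (fun v => Q v : nat) ->
  computable (fun v => P v && Q v : nat).
Proof.
move=> cP cQ; apply: computable_ext (computableM cP cQ) => v.
by rewrite mulnb.
Qed.

Lemma computable_not (P : seq nat -> bool) :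
  computable (fun v => P v : nat) -> computable (fun v => ~~ P v : nat).
Proof.
move=> cP; apply: computable_ext (computableB (computable_const 1) cP) => v.
by case: (P v).
Qed.

Lemma computable_or (P Q : seq nat -> bool) :
  computable (fun v => P v : nat) -> computable (fun v => Q v : nat) ->
  computable (fun v => P v || Q v : nat).
Proof.
move=> cP cQ.
apply: computable_ext (computable_not (computable_and (computable_not cP)
  (computable_not cQ))) => v.
by rewrite negb_and !negbK.
Qed.

Lemma computable_eq F G : computable F -> computable G ->
  computable (fun v => (F v == G v) : nat).
Proof.
move=> cF cG; apply: computable_ext (computable_and (computable_leq cF cG)
  (computable_leq cG cF)) => v.
by rewrite eqn_leq.
Qed.

Lemma computable_exists (B : seq nat -> nat) (P : nat -> seq nat -> bool) :
  computable B -> computable (fun v => P (nth 0%N v 0) (behead v) : nat) ->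
  computable (fun v => [exists j : 'I_(B v), P j v] : nat).
Proof.
move=> cB cP; apply: computable_ext (computable_leq (computable_const 1)
  (computable_sum (G := fun j v => P j v : nat) cB cP)) => v; congr nat_of_bool.
rewrite big_mkord; apply/idP/existsP => [|[j Pj]]; last by rewrite (bigD1 j)//= Pj.
rewrite lt0n sum_nat_eq0 => /forallPn[j]; rewrite negb_imply /=.
by rewrite eqb0 negbK; exists j.
Qed.

(** The quotient counts the positive multiples of [G v] up to [F v]. *)
Lemma computable_div F G : computable F -> computable G ->
  computable (fun v => (F v %/ G v)%N).
Proof.
move=> cF cG.
apply: (computable_ext (F := fun v =>
  \sum_(0 <= j < F v) ((0 < G v) && (j.+1 * G v <= F v)))%N) => [v|].
  set a := F v; set d := G v; have [->|d0] := posnP d.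
    by rewrite divn0 big1.
  have h : (a %/ d <= a)%N by exact: leq_div.
  rewrite big_mkord -(subnKC h) big_split_ord /=.
  rewrite (eq_bigr (fun=> 1%N)); last first.
    by move=> i _; rewrite subnKC// -leq_divRL// ltn_ord.
  rewrite sum_nat_const card_ord muln1 big1 ?addn0 ?subnKC// => i _.
  by rewrite -leq_divRL// ltnNge leq_addr.
apply: computable_sum => //; apply: computable_and.
  by apply: computable_leq; [exact: computable_const|exact: (computable_behead cG)].
apply: computable_leq; last exact: (computable_behead cF).
apply: computableM; last exact: (computable_behead cG).
by apply: computableS; exact: computable_nth.
Qed.

Lemma computable_odd F : computable F -> computable (fun v => odd (F v) : nat).
Proof.
move=> cF; apply: (computable_ext (F := fun v => F v - 2 * (F v %/ 2))%N).
  by move=> v; rewrite divn2 mul2n -{1}(odd_double_half (F v)) addnK.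
have c2 := computable_const 2.
by apply: computableB => //; apply: computableM => //; exact: computable_div.
Qed.

(** * Expectations over finitely many coin tosses *)

Section coin_mean.
Context {R : realType}.
Implicit Types (f g : seq bool -> R) (n : nat).

(** The expectation is defined by recursion on the first toss, so that all its
    properties follow by induction. *)
Fixpoint coin_mean n f : R :=
  if n is m.+1 then
    2^-1 * (coin_mean m (f \o cons true) + coin_mean m (f \o cons false))
  else f [::].

Lemma eq_coin_mean n f g : (forall x, size x = n -> f x = g x) ->
  coin_mean n f = coin_mean n g.
Proof.
elim: n f g => [|n IHn] f g fg /=; first exact: fg.
by congr (_ * (_ + _)); apply: IHn => x xn; apply: fg; rewrite /= xn.
Qed.

Lemma ler_coin_mean n f g : (forall x, size x = n -> f x <= g x) ->
  coin_mean n f <= coin_mean n g.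
Proof.
elim: n f g => [|n IHn] f g fg /=; first exact: fg.
by rewrite ler_pM2l ?invr_gt0// lerD// IHn// => x xn; apply: fg; rewrite /= xn.
Qed.

Lemma coin_meanD n f g :
  coin_mean n (fun x => f x + g x) = coin_mean n f + coin_mean n g.
Proof.
elim: n f g => [//|n IHn] f g /=.
by rewrite (IHn (f \o _) (g \o _)) (IHn (f \o _) (g \o _)); ring.
Qed.

Lemma coin_meanZ n a f : coin_mean n (fun x => a * f x) = a * coin_mean n f.
Proof.
elim: n f => [//|n IHn] f /=.
by rewrite (IHn (f \o _)) (IHn (f \o _)); ring.
Qed.

Lemma coin_mean_cst n a : coin_mean n (fun=> a) = a.
Proof. by elim: n => //= n IHn; rewrite /comp IHn; field. Qed.

Lemma coin_meanN n f : coin_mean n (fun x => - f x) = - coin_mean n f.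
Proof.
rewrite -mulN1r -coin_meanZ; apply: eq_coin_mean => x _.
by rewrite mulN1r.
Qed.

Lemma coin_mean_sum n (I : Type) (s : seq I) (P : pred I)
    (F : I -> seq bool -> R) :
  coin_mean n (fun x => \sum_(i <- s | P i) F i x) =
  \sum_(i <- s | P i) coin_mean n (F i).
Proof.
elim: s => [|i s IHs].
  rewrite big_nil -[RHS](coin_mean_cst n); apply: eq_coin_mean => x _.
  by rewrite big_nil.
rewrite big_cons -IHs; case: ifPn => Pi; last first.
  by apply: eq_coin_mean => x _; rewrite big_cons (negPf Pi).
by rewrite -coin_meanD; apply: eq_coin_mean => x _; rewrite big_cons Pi.
Qed.

Lemma coin_mean_ge0 n f : (forall x, size x = n -> 0 <= f x) ->
  0 <= coin_mean n f.
Proof. by move=> f0; rewrite -(coin_mean_cst n 0); exact: ler_coin_mean. Qed.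

Lemma ler_norm_coin_mean n f : `|coin_mean n f| <= coin_mean n (fun x => `|f x|).
Proof.
rewrite ler_norml -coin_meanN; apply/andP; split; apply: ler_coin_mean => x _.
  by rewrite lerNl -normrN ler_norm.
exact: ler_norm.
Qed.

(** Independence of the first [m] tosses and the next [n]. *)
Lemma coin_mean_cat m n f :
  coin_mean (m + n) f = coin_mean m (fun x => coin_mean n (fun y => f (x ++ y))).
Proof. by elim: m f => //= m IHm f; rewrite !IHm. Qed.

End coin_mean.

Lemma measurable_cylinder x : measurable (cylinder x : set cantor).
Proof. by apply: sub_sigma_algebra; exists x. Qed.

Lemma measurable_cylinders (S : set (seq bool)) :
  measurable (\bigcup_(x in S) cylinder x : set cantor).
Proof.
rewrite bigcup_mkcond; apply: countable_bigcupT_measurable => // x.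
by case: ifP => // _; exact: measurable_cylinder.
Qed.

(** The prefix [p] is there for the induction on [n], whose step moves the first
    bit of the strings to the end of [p]. *)
Lemma fair_coin_cylinders (R : realType) n (P : pred (seq bool)) (p : seq bool) :
  (fair_coin R (\bigcup_(x in [set x | size x = n /\ P x]) cylinder (p ++ x))
   <= (2^-1 ^+ size p * coin_mean n (fun x => (P x)%:R))%:E)%E.
Proof.
have catE (S : set (seq bool)) q : \bigcup_(x in S) cylinder (q ++ x) =
    \bigcup_(x in [set q ++ x | x in S]) cylinder x by rewrite bigcup_image.
elim: n P p => [|n IHn] P p.
  case: (boolP (P [::])) => [Pn|nPn].
    rewrite [coin_mean _ _]/= Pn mulr1 -fair_coin_cylinder.
    apply: (@le_measure _ R cantor (fair_coin R)).
    - by rewrite inE catE; exact: measurable_cylinders.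
    - by rewrite inE; exact: measurable_cylinder.
    - by apply: bigcup_sub => x [/size0nil -> _]; rewrite cats0.
  rewrite bigcup0 ?measure0 ?lee_fin ?mulr_ge0 ?exprn_ge0 ?invr_ge0//=.
  by move=> x [/size0nil ->]; rewrite (negPf nPn).
set V := fun b => \bigcup_(x in [set x | size x = n /\ P (b :: x)])
  cylinder (rcons p b ++ x).
have mV b : measurable (V b : set cantor).
  by rewrite /V catE; exact: measurable_cylinders.
have VU : \bigcup_(x in [set x | size x = n.+1 /\ P x]) cylinder (p ++ x)
    `<=` V true `|` V false.
  apply: bigcup_sub => -[|b x] [//= [xn] Px] w; rewrite -cat_rcons => wx.
  by case: b Px wx => Px wx; [left|right]; exists x.
apply: (@le_trans _ _ (fair_coin R (V true `|` V false))).
  apply: (@le_measure _ R cantor (fair_coin R)); rewrite ?inE//; last exact: measurableU.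
  by rewrite catE; exact: measurable_cylinders.
have U2 : (fair_coin R (V true `|` V false)
    <= fair_coin R (V true) + fair_coin R (V false))%E.
  exact: (@measureU2 _ cantor R).
apply: (le_trans U2).
apply: (le_trans (leeD (IHn (P \o cons true) (rcons p true))
  (IHn (P \o cons false) (rcons p false)))).
by rewrite -EFinD lee_fin !size_rcons exprSr /= -mulrDr mulrA.
Qed.

Arguments coin_mean {R} n f : simpl never.

(** * Fourth moments of sums over independent blocks *)

(** Consecutive blocks have lengths [0], [1], [2], ..., so that the [n]-th one
    starts at [0 + 1 + ... + (n - 1) = 'C(n, 2)]. *)
Definition block (x : seq bool) n := take n (drop 'C(n, 2) x).

Lemma block_cat (x y : seq bool) k n : size x = 'C(k.+1, 2) -> (n <= k)%N ->
  block (x ++ y) n = block x n.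
Proof.
move=> xk nk; have le_x : ('C(n, 2) + n <= size x)%N.
  by rewrite xk; have := @leq_bin2l n.+1 k.+1 2 nk; rewrite binS bin1.
rewrite /block drop_cat; case: ltnP => nx.
  by rewrite takel_cat// size_drop leq_subRL// ltnW.
have -> : n = 0%N by lia.
by rewrite !take0.
Qed.

Lemma block_cat_last (x y : seq bool) k : size x = 'C(k, 2) ->
  size y = k -> block (x ++ y) k = y.
Proof. by move=> xk yk; rewrite /block drop_size_cat// -yk take_size. Qed.

Section block_sums.
Context {R : realType}.
Variables (g : nat -> seq bool -> R) (C : R).
Hypothesis gE : forall n, coin_mean n (g n) = 0.
Hypothesis g4 : forall n, coin_mean n (fun y => g n y ^+ 4) <= C.

Let S k x := \sum_(1 <= n < k.+1) g n (block x n).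

Let S_cat k x y : size x = 'C(k.+1, 2) -> size y = k.+1 ->
  S k.+1 (x ++ y) = S k x + g k.+1 y.
Proof.
move=> xk yk; rewrite /S big_nat_recr//= (@block_cat_last _ _ k.+1)//.
by congr (_ + _); apply: eq_big_nat => n /andP[_ nk]; rewrite (@block_cat _ _ k).
Qed.

Let mean_S (phi : R -> R) k : coin_mean 'C(k.+2, 2) (phi \o S k.+1) =
  coin_mean 'C(k.+1, 2) (fun x =>
    coin_mean k.+1 (fun y => phi (S k x + g k.+1 y))).
Proof.
rewrite binS bin1 coin_mean_cat; apply: eq_coin_mean => x xk.
by apply: eq_coin_mean => y yk /=; rewrite S_cat.
Qed.

Let S0 x : S 0 x = 0. Proof. by rewrite /S big_geq. Qed.

Let mean_S1 k : coin_mean 'C(k.+1, 2) (S k) = 0.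
Proof.
elim: k => [|k IHk]; first by rewrite (eq_coin_mean (g := fun=> 0)) ?coin_mean_cst.
rewrite -[S _]/(id \o S k.+1) mean_S -[RHS]IHk; apply: eq_coin_mean => x _.
by rewrite coin_meanD coin_mean_cst gE addr0.
Qed.


(* The bound is at least [1], so that it also bounds second moments. *)
Let B := Num.max 1 C.

Let g2B n : coin_mean n (fun y => g n y ^+ 2) <= B.
Proof.
apply: (@le_trans _ _ (coin_mean n (fun y => 2^-1 * g n y ^+ 4 + 2^-1))).
  apply: ler_coin_mean => y _; rewrite -subr_ge0.
  rewrite (_ : _ - _ = 2^-1 * (g n y ^+ 2 - 1) ^+ 2); last by field.
  by rewrite mulr_ge0 ?sqr_ge0.
rewrite coin_meanD coin_meanZ coin_mean_cst.
have := g4 n; have : 1 <= B /\ C <= B by rewrite /B !le_max !lexx orbT.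
lra.
Qed.

(** The cross terms vanish, the blocks being independent and centered. *)
Let mean_S2 k : coin_mean 'C(k.+1, 2) (fun x => S k x ^+ 2) <= B * k%:R.
Proof.
elim: k => [|k IHk].
  rewrite (eq_coin_mean (g := fun=> 0)) ?coin_mean_cst ?mulr0// => x _.
  by rewrite S0 expr0n.
rewrite (mean_S (fun t => t ^+ 2)) /=.
rewrite (eq_coin_mean (g := fun x =>
  S k x ^+ 2 + coin_mean k.+1 (fun y => g k.+1 y ^+ 2))); last first.
  move=> x _; rewrite (eq_coin_mean (g := fun y =>
    S k x ^+ 2 + (2 * S k x * g k.+1 y + g k.+1 y ^+ 2))).
    by rewrite !coin_meanD coin_meanZ coin_mean_cst gE mulr0 add0r.
  by move=> y _; ring.
rewrite coin_meanD coin_mean_cst -natr1 mulrDr mulr1.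
by rewrite lerD.
Qed.

(** Adding a block [g] to a sum [S] changes the fourth moment by
    [6 E S^2 E g^2 + E g^4], the terms with a factor [E S] or [E g] being zero;
    as [E S^2] is of order [k], this is of order [k] too. *)
Lemma mean_block_sum4 k :
  coin_mean 'C(k.+1, 2) (fun x => (\sum_(1 <= n < k.+1) g n (block x n)) ^+ 4)
  <= 3 * Num.max 1 C ^+ 2 * k%:R ^+ 2.
Proof.
rewrite -/(S k _) -/B; elim: k => [|k IHk].
  rewrite (eq_coin_mean (g := fun=> 0)) ?coin_mean_cst.
    by rewrite expr0n mulr0.
  by move=> x _; rewrite -/(S 0 x) S0 expr0n.
rewrite (mean_S (fun t => t ^+ 4)) /=.
pose m2 := coin_mean k.+1 (fun y => g k.+1 y ^+ 2).
pose m3 := coin_mean k.+1 (fun y => g k.+1 y ^+ 3).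
pose m4 := coin_mean k.+1 (fun y => g k.+1 y ^+ 4).
rewrite (eq_coin_mean (g := fun x =>
  S k x ^+ 4 + (6 * m2 * S k x ^+ 2 + (4 * m3 * S k x + m4)))); last first.
  move=> x _; rewrite (eq_coin_mean (g := fun y => S k x ^+ 4 +
    (4 * S k x ^+ 3 * g k.+1 y + (6 * S k x ^+ 2 * g k.+1 y ^+ 2 +
    (4 * S k x * g k.+1 y ^+ 3 + g k.+1 y ^+ 4))))); last first.
    by move=> y _; ring.
  rewrite !coin_meanD !coin_meanZ coin_mean_cst gE -/m2 -/m3 -/m4; ring.
rewrite !coin_meanD !coin_meanZ mean_S1 coin_mean_cst mulr0 add0r.
have B1 : 1 <= B by rewrite /B le_max lexx.
have CB : C <= B by rewrite /B le_max lexx orbT.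
have m4B : m4 <= B by rewrite (le_trans (g4 _)).
have m20 : 0 <= m2 by apply: coin_mean_ge0 => y _; exact: sqr_ge0.
have m2S : m2 * coin_mean 'C(k.+1, 2) (fun x => S k x ^+ 2) <= B * (B * k%:R).
  apply: ler_pM => //; last by have := g2B k.+1.
  by apply: coin_mean_ge0 => y _; exact: sqr_ge0.
have BB : B <= B ^+ 2 by rewrite expr2 ler_peMl// (le_trans _ B1).
rewrite -(natr1 k).
apply: (@le_trans _ _ (3 * B ^+ 2 * k%:R ^+ 2 + (6 * (B * (B * k%:R)) + B))).
  by apply: lerD => //; apply: lerD => //; rewrite -(mulrA 6 m2); apply: ler_wpM2l.
rewrite -subr_ge0.
rewrite (_ : _ - _ = 2 * B ^+ 2 + (B ^+ 2 - B)); last by ring.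
by rewrite addr_ge0 ?subr_ge0// mulr_ge0// sqr_ge0.
Qed.

End block_sums.

(** * An effective strong law of large numbers *)

(** The final [1] makes the length of the string the binary logarithm of its
    code. *)
Lemma string_code_bounds x :
  (2 ^ size x <= string_code x < 2 ^ (size x).+1)%N.
Proof.
elim: x => //= b x /andP[l u]; rewrite -/(string_code x).
move: l u; rewrite !expnS; case: b => /=; lia.
Qed.

Lemma odd_string_code x j : (j < size x)%N ->
  odd (string_code x %/ 2 ^ j) = nth false x j.
Proof.
elim: x j => //= b x IHx [_|j jx]; rewrite -/(string_code x).
  by rewrite divn1 oddD odd_double oddb.
rewrite expnS divnMA [RHS]/= -IHx//; congr (odd (_ %/ _)).
by rewrite -muln2 divnMDl// divn_small ?addn0//; case: b.
Qed.

(** Unbounded search turns a decidable set of strings into an enumerated one: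
    on input [i, n] the search looks for [n] itself and diverges when [n] is
    not the code of an accepted string. *)
Lemma enumerated_decidable (D : nat -> nat -> bool) :
  computable (fun v => D (nth 0 v 0) (nth 0 v 1) : nat)%N ->
  exists e : recfun 2, forall i,
    enumerated e i = [set x | D i (string_code x)].
Proof.
move=> cD.
have [f hf] : exists f : recfun 3, represents f (fun v =>
    ~~ ((nth 0 v 0 == nth 0 v 2) && D (nth 0 v 1) (nth 0 v 2)) : nat)%N.
  apply: computable_not; apply: computable_and.
    by apply: computable_eq; exact: computable_nth.
  by apply: computable_ext (computable_behead cD) => v; rewrite !nth_behead.
exists (Mu f) => i; apply/seteqP; split=> x /=.
  move=> [n [/hf /=]]; case: eqP => //= <-.
  by case: (D _ _).
move=> Dx; exists (string_code x); split; first by apply/hf => /=; rewrite eqxx Dx.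
move=> z zx; exists 0%N; apply/hf => /=.
by rewrite ltn_eqF.
Qed.

Definition block_ones (w : nat -> bool) n :=
  (\sum_(0 <= j < n) w ('C(n, 2) + j))%N.

Lemma eq_block_ones w w' n : (forall j, (j < 'C(n.+1, 2))%N -> w j = w' j) ->
  block_ones w n = block_ones w' n.
Proof.
move=> ww'; apply: eq_big_nat => j /andP[_ jn]; rewrite ww'//.
by rewrite binS bin1 ltn_add2l.
Qed.

Lemma count_block x n : ('C(n.+1, 2) <= size x)%N ->
  count id (block x n) = block_ones (nth false x) n.
Proof.
rewrite binS bin1 => nx; rewrite -sum1_count big_mkcond /=.
have sb : size (block x n) = n by rewrite size_takel// size_drop leq_subRL//; lia.
rewrite (big_nth false) sb; apply: eq_big_nat => j /andP[_ jn].
by rewrite nth_take// nth_drop; case: nth.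
Qed.

Section block_average.
(** The statistic [fp n a - fn n a] of a block of length [n] with [a] ones is
    given as a difference because programs compute natural numbers. Its
    averages are compared to the integer [c], with a tolerance of [3]. *)
Variables (fp fn : nat -> nat -> nat) (c : nat).
Let computable2 (f : nat -> nat -> nat) := forall F G,
  computable F -> computable G -> computable (fun v => f (F v) (G v)).
Hypotheses (cfp : computable2 fp) (cfn : computable2 fn).

Let sum (f : nat -> nat -> nat) (w : nat -> bool) k :=
  (\sum_(0 <= n < k) f n.+1 (block_ones w n.+1))%N.

Let eq_sum f w w' k : (forall j, (j < 'C(k.+1, 2))%N -> w j = w' j) ->
  sum f w k = sum f w' k.
Proof.
move=> ww'; apply: eq_big_nat => n /andP[_ nk]; congr (f _ _).
apply: eq_block_ones => j jn; apply: ww'; apply: leq_trans jn _.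
by rewrite leq_bin2l.
Qed.

(* The terms are arranged so that nothing is subtracted. *)
Let deviates w k := (sum fn w k + c * k + 3 * k <= sum fp w k)%N ||
  (sum fp w k + 3 * k <= sum fn w k + c * k)%N.

Let bits a j := odd (a %/ 2 ^ j).

Let computable_bin2 F : computable F -> computable (fun v => 'C(F v, 2)).
Proof.
move=> cF; apply: computable_ext (fun v => triangular_sum (F v)) _.
by apply: computable_sum => //; exact: computable_nth.
Qed.

Let computable_block_ones F G : computable F -> computable G ->
  computable (fun v => block_ones (bits (F v)) (G v)).
Proof.
move=> cF cG; apply: computable_sum => //; apply: computable_odd.
apply: computable_div; first exact: (computable_behead cF).
apply: computableX; first exact: computable_const.
apply: computableD; last exact: computable_nth.
exact/computable_bin2/(computable_behead cG).
Qed.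

Let computable_sum_block f F G : computable2 f -> computable F ->
  computable G -> computable (fun v => sum f (bits (F v)) (G v)).
Proof.
move=> cf cF cG; apply: computable_sum => //; apply: cf.
  exact/computableS/computable_nth.
apply: computable_block_ones; first exact: (computable_behead cF).
exact/computableS/computable_nth.
Qed.

Let computable_deviates F G : computable F -> computable G ->
  computable (fun v => deviates (bits (F v)) (G v) : nat).
Proof.
move=> cF cG.
have cck m : computable (fun v => m * G v)%N.
  by apply: computableM => //; exact: computable_const.
have sp := computable_sum_block cfp cF cG.
have sn := computable_sum_block cfn cF cG.
by apply: computable_or; apply: computable_leq;
   do ?[exact: cck | exact: sp | exact: sn | apply: computableD].
Qed.

(** The strings of the test at level [i] have the length of the first [k] blocks
    for some [k >= K 2^i], and a large deviation on these blocks. The bounds on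
    the code [a] say that its string has that length. *)
Let accepts K i a := [exists k : 'I_a.+1, [&& (K * 2 ^ i <= k)%N,
  (2 ^ 'C(k.+1, 2) <= a)%N, (a < 2 ^ ('C(k.+1, 2).+1))%N & deviates (bits a) k]].

Let computable_accepts K :
  computable (fun v => accepts K (nth 0 v 0) (nth 0 v 1) : nat)%N.
Proof.
have cn := computable_nth.
pose P k v := let a := nth 0%N v 1 in [&& (K * 2 ^ nth 0 v 0 <= k)%N,
  (2 ^ 'C(k.+1, 2) <= a)%N, (a < 2 ^ ('C(k.+1, 2).+1))%N & deviates (bits a) k].
have c2 := computable_const 2.
apply: (computable_exists (B := fun v => (nth 0%N v 1).+1) (P := P)).
  exact: computableS.
have cn' i : computable (fun v => nth 0%N (behead v) i).
  exact: (computable_behead (cn i)).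
have cb : computable (fun v => 'C((nth 0%N v 0).+1, 2)).
  exact/computable_bin2/computableS.
apply: computable_and.
  apply: computable_leq => //; apply: computableM; first exact: computable_const.
  by apply: computableX.
apply: computable_and.
  by apply: computable_leq => //; exact: computableX.
apply: computable_and; last exact: computable_deviates.
apply: computable_leq; first exact: computableS.
by apply: computableX => //; exact: computableS.
Qed.

Let acceptsP K i x : reflect (exists k, [/\ (K * 2 ^ i <= k)%N,
  size x = 'C(k.+1, 2) & deviates (nth false x) k]) (accepts K i (string_code x)).
Proof.
have dE k : size x = 'C(k.+1, 2) ->
    deviates (bits (string_code x)) k = deviates (nth false x) k.
  move=> xk; rewrite /deviates; congr (_ || _);
  by rewrite !(@eq_sum _ (bits (string_code x)) (nth false x))// => j jk;
     apply: odd_string_code; rewrite xk.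
have /andP[lx ux] := string_code_bounds x.
apply: (iffP existsP) => [[k /and4P[Kk lk uk dk]]|[k [Kk xk dk]]].
  have xk : size x = 'C(k.+1, 2).
    apply/eqP; rewrite eqn_leq; apply/andP; split.
      by rewrite -ltnS -(ltn_exp2l _ _ (ltnSn 1)) (leq_ltn_trans lx).
    by rewrite -ltnS -(ltn_exp2l _ _ (ltnSn 1)) (leq_ltn_trans lk).
  by exists k; rewrite -dE.
suff kx : (k < (string_code x).+1)%N.
  by exists (Ordinal kx); rewrite /= -xk lx ux dE// dk Kk.
rewrite ltnS (leq_trans _ lx)// xk (leq_trans _ (ltnW (ltn_expl _ (ltnSn 1))))//.
by rewrite binS bin1 leq_addl// (leq_trans _ (leq_addl _ _)).
Qed.

Variables (R : realType) (C : R).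
Let f n a : R := (fp n a)%:R - (fn n a)%:R.
Let mean n := coin_mean n (fun y => f n (count id y)).
Hypothesis f4 : forall n, coin_mean n (fun y => f n (count id y) ^+ 4) <= C.
Hypothesis mean_c : \forall k \near \oo,
  `|\sum_(0 <= n < k) mean n.+1 - (c * k)%:R| <= 2 * k%:R.

Let deviatesE w k : deviates w k =
  (3 * k%:R <= `|\sum_(0 <= n < k) f n.+1 (block_ones w n.+1) - (c * k)%:R|).
Proof.
rewrite sumrB -!natr_sum -/(sum fp w k) -/(sum fn w k) ler_normr /deviates.
rewrite -!(ler_nat R) !natrD.
by congr (_ || _); apply/idP/idP; lra.
Qed.

Let mean4_centered n : coin_mean n (fun y => (f n (count id y) - mean n) ^+ 4)
  <= 8 * (C + (C + 1) ^+ 4).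
Proof.
have pow4 (a b : R) : (a - b) ^+ 4 <= 8 * (a ^+ 4 + b ^+ 4).
  rewrite -subr_ge0 (_ : _ - _ = (a + b) ^+ 4 + 6 * (a ^+ 2 - b ^+ 2) ^+ 2).
    by rewrite addr_ge0 ?exprn_even_ge0// mulr_ge0 ?sqr_ge0.
  by ring.
have mC : `|mean n| <= C + 1.
  apply: (le_trans (ler_norm_coin_mean _ _)).
  apply: (@le_trans _ _ (coin_mean n (fun y => f n (count id y) ^+ 4 + 1))).
    apply: ler_coin_mean => y _; set a := f n _.
    have -> : a ^+ 4 = `|a| ^+ 4.
      by rewrite -normrX ger0_norm ?exprn_even_ge0.
    have [a1|a1] := leP `|a| 1; first by rewrite (le_trans a1)// lerDr exprn_ge0.
    rewrite (@le_trans _ _ (`|a| ^+ 4)) ?lerDl//.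
    by rewrite -{1}[`|a|]expr1 ler_weXn2l// ltW.
  by rewrite coin_meanD coin_mean_cst lerD2r.
apply: (@le_trans _ _ (coin_mean n (fun y =>
    8 * (f n (count id y) ^+ 4 + mean n ^+ 4)))).
  by apply: ler_coin_mean => y _.
rewrite coin_meanZ coin_meanD coin_mean_cst ler_pM2l// lerD//.
rewrite -[mean n ^+ 4]ger0_norm ?normrX; last by rewrite exprn_even_ge0.
by rewrite lerXn2r// ?nnegrE// (le_trans _ mC).
Qed.

Let D : R := 3 * Num.max 1 (8 * (C + (C + 1) ^+ 4)) ^+ 2.

Let D_ge0 : 0 <= D. Proof. by rewrite mulr_ge0// sqr_ge0. Qed.

(** Chebyshev's inequality with the fourth moment. Of the tolerance [3 k], the
    expected value takes [2 k], which leaves [k] to the fluctuations. *)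
Let mean_deviates : \forall k \near \oo,
  coin_mean 'C(k.+1, 2) (fun x => (deviates (nth false x) k)%:R)
  <= D / k%:R ^+ 2.
Proof.
near=> k; have k0 : 0 < (k%:R : R) by rewrite ltr0n; near: k; exact: nbhs_infty_gt.
pose g n y := f n (count id y) - mean n.
have g0 n : coin_mean n (g n) = 0.
  by rewrite coin_meanD coin_mean_cst -/(mean n) subrr.
have S4 := mean_block_sum4 g0 mean4_centered k.
apply: (@le_trans _ _ (k%:R ^- 4 * (D * k%:R ^+ 2))); last first.
  by rewrite le_eqVlt; apply/orP; left; apply/eqP; field; rewrite gt_eqF.
apply: le_trans (ler_wpM2l _ S4); last by rewrite invr_ge0 exprn_ge0// ltW.
rewrite -coin_meanZ; apply: ler_coin_mean => x xk.
have [|_] := boolP (deviates _ _); last first.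
  by rewrite mulr_ge0 ?invr_ge0 ?exprn_even_ge0.
rewrite deviatesE => dev; rewrite ler_pdivlMl ?exprn_gt0// mulr1.
rewrite big_add1 /=.
set S := (X in _ <= X ^+ 4).
have kS : k%:R <= `|S|.
  have -> : S = \sum_(0 <= n < k) f n.+1 (block_ones (nth false x) n.+1)
     - \sum_(0 <= n < k) mean n.+1.
    rewrite -sumrB; apply: eq_big_nat => n /andP[_ nk].
    by rewrite /g count_block// xk leq_bin2l.
  have : `|\sum_(0 <= n < k) mean n.+1 - (c * k)%:R| <= 2 * k%:R by near: k.
  move: dev; set a := \sum_(0 <= n < k) f _ _; set b := \sum_(0 <= n < k) mean _.
  have := ler_normD (a - b) (b - (c * k)%:R); rewrite subrKA; lra.
have -> : S ^+ 4 = `|S| ^+ 4 by rewrite -normrX ger0_norm ?exprn_even_ge0.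
by rewrite lerXn2r// nnegrE ltW.
Unshelve. all: by end_near. Qed.

(** The deviations for [k >= M = K 2^i] have total measure at most
    [\sum_(k >= M) D / k^2 <= 2 D / M], which is at most [2^-i] if [K >= 2 D].
    They form a test, and a random sequence leaves it at some level. *)
Lemma random_block_average w : martin_lof_random R w -> \forall k \near \oo,
  `|\sum_(0 <= n < k) f n.+1 (block_ones w n.+1) - (c * k)%:R| < 3 * k%:R.
Proof.
have [k0 _ devk0] := mean_deviates.
pose K := (maxn k0 (Num.truncn (2 * D))).+1.
have [e eE] := enumerated_decidable (computable_accepts K).
pose U i := \bigcup_(x in enumerated e i) cylinder x.
pose V k := \bigcup_(x in [set x | size x = 'C(k.+1, 2) /\
  deviates (nth false x) k]) cylinder ([::] ++ x).
have Kk0 i : (k0 <= K * 2 ^ i)%N.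
  by rewrite (leq_trans _ (leq_pmulr _ _)) ?expn_gt0// leqW// leq_maxl.
have UV i : U i `<=` \bigcup_j V (K * 2 ^ i + j)%N.
  apply: bigcup_sub => x; rewrite eE /= => /acceptsP[k [Kk xk dk]] w' w'x.
  by exists (k - K * 2 ^ i)%N => //; exists x; rewrite ?subnKC.
have mV k : measurable (V k : set cantor) by exact: measurable_cylinders.
have lV k : (k0 <= k)%N -> (fair_coin R (V k) <= (D / k%:R ^+ 2)%:E)%E.
  move=> /devk0 dk; apply: le_trans (fair_coin_cylinders _ _ _ _) _.
  by rewrite expr0 mul1r lee_fin.
have tU : martin_lof_test R U.
  split; first by exists e.
  move=> i i1; set M := (K * 2 ^ i)%N.
  have M0 : (0 < M)%N by rewrite muln_gt0 expn_gt0.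
  apply: (@le_trans _ _ (\sum_(0 <= j <oo) fair_coin R (V (M + j)%N))%E).
    apply: (@measure_sigma_subadditive _ R cantor (fair_coin R)) => //.
    exact: measurable_cylinders.
  apply: lime_le; first by apply: is_cvg_nneseries => n _ _; exact: measure_ge0.
  apply: nearW => n.
  apply: (@le_trans _ _ (\sum_(0 <= j < n) (D / (M + j)%:R ^+ 2)%:E)%E).
    by apply: lee_sum => j _; apply: lV; rewrite (leq_trans (Kk0 i))// leq_addr.
  rewrite sumEFin lee_fin.
  (* 1 / x^2 <= 2 (1 / x - 1 / (x + 1)) makes the sum telescope *)
  apply: (@le_trans _ _ (2 * D * (M%:R^-1 - (M + n)%:R^-1))).
    elim: n => [|n IHn]; first by rewrite big_geq// addn0 subrr mulr0.
    rewrite big_nat_recr//= (le_trans (lerD IHn (lexx _)))//.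
    have x1 : 1 <= (M + n)%:R :> R by rewrite ler1n addn_gt0 M0.
    rewrite addnS -(natr1 (M + n)); move: M%:R^-1 (M + n)%:R x1 => y x x1.
    have x0 : x != 0 by rewrite gt_eqF// (lt_le_trans _ x1).
    have x10 : x + 1 != 0 by apply: lt0r_neq0; lra.
    rewrite -subr_ge0 (_ : _ - _ = D * (x - 1) * (x ^- 2 * (x + 1)^-1)).
      do 2?apply: mulr_ge0 => //; rewrite ?divr_ge0 ?invr_ge0 ?sqr_ge0//.
        by rewrite subr_ge0.
      by lra.
    by field; rewrite x10 x0.
  apply: (@le_trans _ _ (2 * D * M%:R^-1)).
    by apply: ler_wpM2l; [exact: mulr_ge0 | rewrite gerBl invr_ge0].
  rewrite ler_pdivrMr ?ltr0n// /M natrM natrX exprVn [leRHS]mulrCA.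
  rewrite mulVf ?mulr1 ?expf_neq0//.
  apply: (le_trans (ltW (truncnS_gt _))).
  by rewrite ler_nat ltnS leq_maxr.
move=> /(_ U tU) /= nU.
have [i [i1 nUi]] : exists i, (1 <= i)%N /\ ~ U i w.
  apply: contrapT => h; apply: nU => i /= i1; apply: contrapT => nUi.
  by apply: h; exists i.
exists (K * 2 ^ i)%N => // k /= Kk; rewrite ltNge -deviatesE.
apply/negP => dk; apply: nUi; exists (mkseq w 'C(k.+1, 2)); last first.
  by rewrite /cylinder /= size_mkseq.
rewrite eE /=; apply/acceptsP; exists k; split => //; rewrite ?size_mkseq//.
move: dk; rewrite /deviates !(@eq_sum _ w (nth false (mkseq w 'C(k.+1, 2))))//;
by move=> j jk; rewrite nth_mkseq.
Qed.

End block_average.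

(** * Moments of the standardized coin walk *)

Lemma normal_momentS m : normal_moment m.+1 = (m * normal_moment m.-1)%N.
Proof.
case: m => [|m] //; rewrite /normal_moment /= negbK; case: odd => /=.
  by rewrite muln0.
by case: m => [|m] //; rewrite muln1.
Qed.

Section coin_walk.
Context {R : realType}.
Implicit Types (n m : nat) (h : R -> R).

(** The position after [n] steps [+1] or [-1], [a] of them being [+1]. *)
Definition walk n a : R := a.*2%:R - n%:R.

Let mean n h := coin_mean n (fun y => h (walk n (count id y))).

Let meanS n h : mean n.+1 h =
  2^-1 * (mean n (fun x => h (x + 1)) + mean n (fun x => h (x - 1))).
Proof.
rewrite /mean /coin_mean -/(@coin_mean R); congr (_ * (coin_mean _ _ + coin_mean _ _)).
  apply/funext => y /=; congr h.
  by rewrite /walk -!mul2n !(natrM, natrD) -(natr1 n); ring.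
by apply/funext => y /=; congr h; rewrite /walk add0n -(natr1 n); ring.
Qed.

Let mean0 h : mean 0 h = h 0.
Proof. by rewrite /mean /coin_mean /walk subrr. Qed.

Let meanD n h1 h2 : mean n (fun x => h1 x + h2 x) = mean n h1 + mean n h2.
Proof. exact: coin_meanD. Qed.

Let meanN n h : mean n (fun x => - h x) = - mean n h.
Proof. exact: coin_meanN. Qed.

Let mean_half_diff n h1 h2 : mean n (fun x => 2^-1 * (h1 x - h2 x)) =
  2^-1 * (mean n h1 - mean n h2).
Proof. by rewrite /mean coin_meanZ coin_meanD coin_meanN. Qed.

(** The discrete counterpart of [E (N h(N)) = E h'(N)] for a Gaussian [N]: the
    analogue of integration by parts. *)
Lemma coin_mean_stein n h :
  coin_mean n.+1 (fun y => walk n.+1 (count id y) * h (walk n.+1 (count id y))) =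
  n.+1%:R * coin_mean n (fun y => 2^-1 * (h (walk n (count id y) + 1)
                                       - h (walk n (count id y) - 1))).
Proof.
rewrite -/(mean n.+1 (fun x => x * h x)).
rewrite -/(mean n (fun x => 2^-1 * (h (x + 1) - h (x - 1)))).
elim: n h => [|n IHn] h.
  by rewrite meanS !mean0; ring.
rewrite meanS.
have -> : mean n.+1 (fun x => (x + 1) * h (x + 1)) =
    mean n.+1 (fun x => x * h (x + 1)) + mean n.+1 (fun x => h (x + 1)).
  by rewrite -meanD; congr mean; apply/funext => x; ring.
have -> : mean n.+1 (fun x => (x - 1) * h (x - 1)) =
    mean n.+1 (fun x => x * h (x - 1)) + mean n.+1 (fun x => - h (x - 1)).
  by rewrite -meanD; congr mean; apply/funext => x; ring.
rewrite (IHn (fun x => h (x + 1))) (IHn (fun x => h (x - 1))) meanN.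
rewrite !mean_half_diff !meanS -(natr1 n.+1).
have -> : (fun x => h (x - 1 + 1)) = (fun x => h (x + 1 - 1)).
  by apply/funext => x; rewrite subrK addrK.
by field.
Qed.

Lemma half_diff_expr (x : R) m : 2^-1 * ((x + 1) ^+ m - (x - 1) ^+ m) =
  \sum_(i < m.+1 | odd i) 'C(m, i)%:R * x ^+ (m - i).
Proof.
rewrite !exprDn -sumrB big_distrr/= [RHS]big_mkcond/=; apply: eq_bigr => i _.
rewrite expr1n mulr1 -signr_odd -mulr_natl -[in X in _ - X]mulr_natl.
by case: odd => /=; rewrite ?expr1 ?expr0 ?mulrN1 ?mulr1; field.
Qed.

Let s n : R := (Num.sqrt n.+1%:R)^-1.
Let r n : R := Num.sqrt n%:R * s n.

Let s0 : s n @[n --> \oo] --> 0.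
Proof.
have -> : s = Num.sqrt \o harmonic by apply/funext => n /=; rewrite sqrtrV.
rewrite -[X in _ --> X]sqrtr0.
exact: (cvg_comp _ _ (@cvg_harmonic R) (@sqrt_continuous R 0)).
Qed.

Let r1 : r n @[n --> \oo] --> (1 : R).
Proof.
have r2 n : r n ^+ 2 = 1 - harmonic n.
  rewrite /r /s exprMn exprVn !sqr_sqrtr// /harmonic /= -(natr1 n); field.
  by rewrite natr1 pnatr_eq0.
have c2 : r n ^+ 2 @[n --> \oo] --> (1 : R).
  have -> : (fun n => r n ^+ 2) = (fun n => 1 - harmonic n) by exact/funext.
  by have := cvgB (cvg_cst (1 : R)) (@cvg_harmonic R); rewrite subr0; apply.
apply: (squeeze_cvgr (h := cst 1) _ c2); last exact: cvg_cst.
apply: nearW => n.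
have r0 : 0 <= r n by rewrite mulr_ge0 ?invr_ge0 ?sqrtr_ge0.
have : r n ^+ 2 <= 1 by rewrite r2 gerBl invr_ge0.
rewrite expr_le1// => r_1.
by rewrite r_1 expr2 ler_piMl.
Qed.

(** In the recursion from [coin_mean_stein], the term with index [i] carries a
    factor [s^(i-1)], where [s = 1 / sqrt (n + 1)]. In the limit only the term
    with [i = 1] is left, which gives the recursion [normal_momentS]. *)
Lemma cvg_walk_moment m :
  coin_mean n (fun y => ((Num.sqrt n%:R)^-1 * walk n (count id y)) ^+ m)
    @[n --> \oo] --> ((normal_moment m)%:R : R).
Proof.
pose a m n := coin_mean n (fun y => ((Num.sqrt n%:R)^-1 * walk n (count id y)) ^+ m).
rewrite -/(a m); elim/ltn_ind: m => -[_|m IHm].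
  have -> : a 0%N = cst 1; last exact: cvg_cst.
  by apply/funext => n; rewrite /a (eq_coin_mean (g := fun=> 1)) ?coin_mean_cst.
rewrite -cvg_shiftS /=.
pose u i n := 'C(m, i)%:R * (r n ^+ (m - i) * s n ^+ i.-1 * a (m - i)%N n).
have aS : \forall n \near \oo, \sum_(i < m.+1 | odd i) u i n = a m.+1 n.+1.
  near=> n.
  have n0 : (0 < n)%N by near: n; exact: nbhs_infty_gt.
  have q0 : Num.sqrt n%:R != 0 :> R by rewrite sqrtr_eq0 -ltNge ltr0n.
  have q1 : Num.sqrt n.+1%:R != 0 :> R by rewrite sqrtr_eq0 -ltNge ltr0n.
  have -> : a m.+1 n.+1 = s n ^+ m.+1 * coin_mean n.+1 (fun y =>
      walk n.+1 (count id y) * (fun x => x ^+ m) (walk n.+1 (count id y))).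
    by rewrite -coin_meanZ; apply: eq_coin_mean => y _; rewrite exprMn -exprS.
  rewrite (@coin_mean_stein n (fun x => x ^+ m)).
  rewrite (eq_coin_mean (g := fun y => \sum_(i < m.+1 | odd i)
    'C(m, i)%:R * walk n (count id y) ^+ (m - i))); last first.
    by move=> y _; exact: half_diff_expr.
  rewrite coin_mean_sum !mulr_sumr; apply: eq_bigr => i oi.
  have -> : coin_mean n (fun y =>
        'C(m, i)%:R * walk n (count id y) ^+ (m - i)) =
      'C(m, i)%:R * (Num.sqrt n%:R ^+ (m - i) * a (m - i)%N n).
    rewrite coin_meanZ; congr (_ * _); rewrite -coin_meanZ; apply: eq_coin_mean => y _.
    by rewrite -exprMn mulVKf.
  have i0 : (0 < i)%N by case: (val i) oi.
  have im : (i <= m)%N by rewrite -ltnS.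
  have -> : n.+1%:R = s n ^- 2 by rewrite /s exprVn invrK sqr_sqrtr.
  have -> : s n ^+ m.+1 = s n ^+ 2 * (s n ^+ (m - i) * s n ^+ i.-1).
    by rewrite -!exprD; congr (_ ^+ _); lia.
  rewrite /u /r exprMn; field.
  by rewrite invr_eq0.
apply: (cvg_trans (near_eq_cvg aS)).
have -> : (normal_moment m.+1)%:R =
    \sum_(i < m.+1 | odd i) 'C(m, i)%:R * (1 ^+ (m - i) * 0 ^+ i.-1 *
      (normal_moment (m - i))%:R) :> R.
  rewrite normal_momentS; case: m {IHm a u aS} => [|m].
    by rewrite big_mkcond big_ord1 mul0n.
  rewrite (bigD1 (lift ord0 ord0))//= big1 => [|i /andP[oi]].
    by rewrite bin1 subn1 expr1n expr0 !mul1r addr0 natrM.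
  rewrite -val_eqE /= /bump /= => i1.
  by rewrite expr0n (_ : i.-1 == 0%N = false) ?mulr0 ?mul0r ?mulr0//; lia.
apply: cvg_big => [|i oi]; first exact: add_continuous.
have cX (v : nat -> R) (l : R) k : v n @[n --> \oo] --> l ->
    v n ^+ k @[n --> \oo] --> l ^+ k.
  by move=> vl; apply: (cvg_comp _ _ vl (@exprn_continuous R k l)).
apply: cvgMl_tmp; apply: cvgM; last by apply: IHm; rewrite ltnS leq_subr.
by apply: cvgM; apply: cX.
Unshelve. all: by end_near. Qed.

End coin_walk.

(** * Averages of powers along a random sequence *)

Section moment_digits.
Variables (Q m : nat).

(** At most one of the truncated differences is not zero: this is
    [|walk n a|]. *)
Let dist n a := ((2 * a - n) + (n - 2 * a))%N.

Let negative n a := odd m && (2 * a < n)%N.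

(** The integer part of [Q |walk n a|^m / n^(m/2)], in integer arithmetic: the
    number of [z > 0] with [z^2 n^m <= Q^2 |walk n a|^(2m)]. *)
Let magnitude n a := (\sum_(0 <= z < Q * dist n a ^ m)
  ((z.+1) ^ 2 * n ^ m <= Q ^ 2 * dist n a ^ (2 * m)))%N.

(** The integer part of [Q X^m], towards [0], splits into a positive and a
    negative part. *)
Definition moment_pos n a := (~~ negative n a * magnitude n a)%N.
Definition moment_neg n a := (negative n a * magnitude n a)%N.

Let computable_dist F G : computable F -> computable G ->
  computable (fun v => dist (F v) (G v)).
Proof.
move=> cF cG; have cd : computable (fun v => 2 * G v)%N.
  by apply: computableM => //; exact: computable_const.
by apply: computableD; exact: computableB.
Qed.

Let computable_negative F G : computable F -> computable G ->
  computable (fun v => negative (F v) (G v) : nat).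
Proof.
move=> cF cG; apply: computable_and; first exact: computable_const.
apply: computable_leq => //; apply: computableS.
by apply: computableM => //; exact: computable_const.
Qed.

Let computable_magnitude F G : computable F -> computable G ->
  computable (fun v => magnitude (F v) (G v)).
Proof.
move=> cF cG; have cc := computable_const.
apply: computable_sum.
  by apply: computableM => //; apply: computableX => //; exact: computable_dist.
have cF' := computable_behead cF; have cG' := computable_behead cG.
apply: computable_leq; apply: computableM => //; apply: computableX => //.
  exact/computableS/computable_nth.
exact: computable_dist.
Qed.

Lemma computable_moment_pos F G : computable F -> computable G ->
  computable (fun v => moment_pos (F v) (G v)).
Proof.
move=> cF cG; apply: computableM; last exact: computable_magnitude.
exact/computable_not/computable_negative.
Qed.

Lemma computable_moment_neg F G : computable F -> computable G ->
  computable (fun v => moment_neg (F v) (G v)).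
Proof.
move=> cF cG; apply: computableM; last exact: computable_magnitude.
exact: computable_negative.
Qed.

Context {R : realType}.

Let X n a : R := (Num.sqrt n%:R)^-1 * walk n a.

Let distE n a : (dist n a)%:R = `|walk n a| :> R.
Proof.
rewrite /dist /walk -mul2n natrD; case: (leqP n (2 * a)) => [na|/ltnW an].
  by rewrite (eqP na) addr0 natrB// ger0_norm// subr_ge0 ler_nat.
by rewrite (eqP an) add0r natrB// distrC ger0_norm// subr_ge0 ler_nat.
Qed.

Let magnitudeE n a : (0 < n)%N -> magnitude n a = Num.truncn (Q%:R * `|X n a| ^+ m).
Proof.
move=> n0; set t := _ * _.
have q1 : 1 <= Num.sqrt n%:R :> R by rewrite -[leLHS]sqrtr1 ler_wsqrtr// ler1n.
have q0 : 0 < Num.sqrt n%:R :> R by rewrite (lt_le_trans _ q1).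
have tE : t = Q%:R * (dist n a)%:R ^+ m / Num.sqrt n%:R ^+ m.
  by rewrite /t normrM normfV (ger0_norm (ltW q0)) exprMn -distE exprVn; ring.
have t0 : 0 <= t by rewrite mulr_ge0// exprn_ge0.
have tN : (Num.truncn t <= Q * dist n a ^ m)%N.
  rewrite -(ler_nat R) (@le_trans _ _ t) ?truncn_le//.
  by rewrite tE natrM natrX ler_pdivrMr ?exprn_gt0//
    ler_peMr ?exprn_ege1// mulr_ge0// exprn_ge0.
rewrite /magnitude (eq_big_nat _ _ (F2 := fun z => (z < Num.truncn t)%N : nat)).
  rewrite (big_cat_nat (leq0n _) tN)//= (eq_big_nat _ _ (F2 := fun=> 1%N)).
    rewrite sum_nat_const_nat subn0 muln1 big_nat big1 ?addn0// => z /andP[tz _].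
    by rewrite ltnNge tz.
  by move=> z /andP[_ ->].
move=> z _; congr nat_of_bool.
rewrite truncn_gt_nat tE ler_pdivlMr ?exprn_gt0//.
rewrite -(@ler_pXn2r _ 2) ?nnegrE ?mulr_ge0 ?exprn_ge0 ?(ltW q0)//.
have -> : (z.+1%:R * Num.sqrt n%:R ^+ m) ^+ 2 = (z.+1 ^ 2 * n ^ m)%:R :> R.
  by rewrite exprMn -exprM mulnC exprM sqr_sqrtr// natrM !natrX.
have -> : (Q%:R * (dist n a)%:R ^+ m) ^+ 2 = (Q ^ 2 * dist n a ^ (2 * m))%:R :> R.
  by rewrite exprMn -exprM mulnC natrM !natrX.
by rewrite ler_nat.
Qed.

Let digit n a : R := (moment_pos n a)%:R - (moment_neg n a)%:R.

Let signX n a : X n a ^+ m = (-1) ^+ negative n a * `|X n a| ^+ m.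
Proof.
have Xlt0 : (2 * a < n)%N -> X n a <= 0.
  move=> an; rewrite mulr_ge0_le0 ?invr_ge0 ?sqrtr_ge0// subr_le0 -mul2n.
  by rewrite ler_nat ltnW.
have Xge0 : (n <= 2 * a)%N -> 0 <= X n a.
  move=> na; rewrite mulr_ge0 ?invr_ge0 ?sqrtr_ge0// subr_ge0 -mul2n.
  by rewrite ler_nat.
rewrite /negative; case: (boolP (odd m)) => om /=; last first.
  by rewrite expr0 mul1r -normrX ger0_norm// exprn_even_ge0.
case: ltnP => [/Xlt0 X0|/Xge0 X0].
  by rewrite expr1 ler0_norm// exprNn -signr_odd om expr1 mulrA mulrNN !mul1r.
by rewrite expr0 mul1r ger0_norm.
Qed.

Let digitE n a : digit n a = (-1) ^+ negative n a * (magnitude n a)%:R.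
Proof.
rewrite /digit /moment_pos /moment_neg; case: negative => /=.
  by rewrite mul0n mul1n add0r expr1 mulN1r.
by rewrite mul0n mul1n subr0 expr0 mul1r.
Qed.

Lemma ler_norm_digit n a : (0 < n)%N ->
  `|digit n a - Q%:R * X n a ^+ m| <= 1.
Proof.
move=> n0; rewrite digitE magnitudeE// signX mulrCA -mulrBr normrM normr_sign mul1r.
have t0 : 0 <= Q%:R * `|X n a| ^+ m by rewrite mulr_ge0// exprn_ge0.
have /andP[] := truncn_itv t0; rewrite -(natr1 (Num.truncn _)).
by move: (Num.truncn _)%:R => y l u; rewrite ler_norml; lra.
Qed.

(** Rounding towards [0] keeps the fourth moments bounded. *)
Lemma digit4_le n a : (0 < n)%N || (a == 0)%N ->
  digit n a ^+ 4 <= Q%:R ^+ 4 * X n a ^+ (4 * m).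
Proof.
have e4 (x : R) : x ^+ 4 = `|x| ^+ 4 by rewrite -normrX ger0_norm ?exprn_even_ge0.
move=> na; rewrite mulnC exprM -exprMn e4 [leRHS]e4 lerXn2r ?nnegrE//.
rewrite digitE normrM normr_sign mul1r ger0_norm// normrM normrX ger0_norm//.
have [n0|n0] := posnP n; last first.
  by rewrite magnitudeE// truncn_le mulr_ge0// exprn_ge0.
move: na; rewrite n0 /= => /eqP ->.
have -> : X 0 0 = 0 by rewrite /X /walk subrr mulr0.
rewrite normr0 (_ : _ * _ = (Q * 0 ^ m)%:R); last by rewrite natrM natrX.
rewrite ler_nat.
apply: (@leq_trans (\sum_(0 <= z < Q * 0 ^ m) 1)%N).
  by apply: leq_sum => z _; exact: leq_b1.
by rewrite sum_nat_const_nat subn0 muln1.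
Qed.

End moment_digits.

Lemma block_sumE (R : realType) (w : cantor) n : (0 < n)%N ->
  block_sum R w n = (Num.sqrt n%:R)^-1 * walk n (block_ones w n).
Proof.
move=> n0; rewrite /block_sum /walk -mul2n natrM; congr (_ * (2 * _%:R - _)).
have -> : ((n * (n - 1))./2 = 'C(n, 2))%N by rewrite bin2 subn1.
have -> : ((n * (n + 1))./2 = 'C(n, 2) + n)%N.
  by have := bin2 n.+1; rewrite binS bin1 addn1 mulnC.
rewrite big_add1 /= -{1}['C(n, 2)]add0n big_addn addKn.
by apply: eq_bigr => j _; rewrite addnC.
Qed.

(** For each [Q], the effective law of large numbers applies to the integer parts
    of [Q X_n^m]. It locates their averages up to [3], hence those of [X_n^m] up
    to [4 / Q]: rounding costs another [1 / Q]. *)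
Lemma random_moment_average (R : realType) (w : cantor) m :
  martin_lof_random R w ->
  k%:R^-1 * (\sum_(1 <= i < k.+1) block_sum R w i ^+ m) @[k --> \oo]
    --> ((normal_moment m)%:R : R).
Proof.
move=> wR; set nu : R := (normal_moment m)%:R.
pose X n a : R := (Num.sqrt n%:R)^-1 * walk n a.
pose a p n := coin_mean n (fun y => X n (count id y) ^+ p).
have ap p : a p n @[n --> \oo] --> ((normal_moment p)%:R : R).
  exact: cvg_walk_moment.
apply/cvgrPdist_lt => e e0.
pose Q := (Num.truncn (4 / e)).+1.
have Qe : 4 / Q%:R < e.
  by rewrite ltr_pdivrMr// -ltr_pdivrMl// mulrC truncnS_gt.
pose f n b : R := (moment_pos Q m n b)%:R - (moment_neg Q m n b)%:R.
have [M M0 aM] : exists2 M, 0 < M & forall n, a (4 * m)%N n <= M.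
  have /cvgP/cvg_seq_bounded/pinfty_ex_gt0[M M0 /= aM] := ap (4 * m)%N.
  by exists M => // n; rewrite (le_trans (ler_norm _))// aM.
have f4 n : coin_mean n (fun y => f n (count id y) ^+ 4) <= Q%:R ^+ 4 * M.
  apply: (@le_trans _ _ (coin_mean n (fun y =>
      Q%:R ^+ 4 * X n (count id y) ^+ (4 * m)))).
    apply: ler_coin_mean => y yn; apply: digit4_le.
    by case: n yn => //= /size0nil ->.
  by rewrite coin_meanZ; apply: ler_wpM2l; [exact: exprn_ge0 | exact: aM].
have sQ k (u v : nat -> R) : (forall n, `|u n - Q%:R * v n| <= 1) ->
    `|\sum_(0 <= n < k) u n - Q%:R * \sum_(0 <= n < k) v n| <= k%:R.
  move=> uv; rewrite mulr_sumr -sumrB (le_trans (ler_norm_sum _ _ _))//.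
  rewrite (le_trans (ler_sum _ (fun n _ => uv n)))// big_mkord sumr_const card_ord.
  by [].
have mf n : `|coin_mean n.+1 (fun y => f n.+1 (count id y)) - Q%:R * a m n.+1| <= 1.
  rewrite -coin_meanZ -coin_meanN -coin_meanD (le_trans (ler_norm_coin_mean _ _))//.
  rewrite -[leRHS](coin_mean_cst n.+1); apply: ler_coin_mean => y _.
  exact: ler_norm_digit.
have mean_f : \forall k \near \oo,
    `|\sum_(0 <= n < k) coin_mean n.+1 (fun y => f n.+1 (count id y)) -
      (Q * normal_moment m * k)%:R| <= 2 * k%:R.
  have /cesaro/cvgrPdist_lt : a m n.+1 @[n --> \oo] --> nu by rewrite cvg_shiftS.
  move=> /(_ Q%:R^-1); rewrite invr_gt0 ltr0n => /(_ isT) [N _ hN].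
  exists N.+1 => // -[//|k] Nk; have {hN} := hN k Nk.
  rewrite /arithmetic_mean /series /=.
  have := sQ k.+1 _ _ mf; set F := \sum_(_ <= _ < _) coin_mean _ _.
  set S := \sum_(_ <= _ < _) a _ _ => FS kS.
  have {kS} QS : `|Q%:R * S - (Q * normal_moment m * k.+1)%:R| <= k.+1%:R.
    have -> : Q%:R * S - (Q * normal_moment m * k.+1)%:R =
        - (Q%:R * k.+1%:R * (nu - k.+1%:R^-1 * S)).
      by rewrite !natrM /nu; field; rewrite ?nat1r ?natr1 pnatr_eq0.
    rewrite normrN normrM ger0_norm ?mulr_ge0// mulrAC ler_piMl//.
    by rewrite -ler_pdivlMl ?ltr0n// mulr1 ltW.
  have := ler_normD (F - Q%:R * S) (Q%:R * S - (Q * normal_moment m * k.+1)%:R).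
  by rewrite subrKA; lra.
have := random_block_average (computable_moment_pos Q m)
  (computable_moment_neg Q m) f4 mean_f wR.
move=> [N _ hN]; exists N.+1 => // -[//|k] Nk; have {hN} := hN k.+1 (ltnW Nk).
rewrite big_add1 /=.
have Xf n : `|f n.+1 (block_ones w n.+1) - Q%:R * block_sum R w n.+1 ^+ m| <= 1.
  by rewrite block_sumE//; exact: ler_norm_digit.
have := sQ k.+1 _ _ Xf; set F := \sum_(_ <= _ < _) ((_ _ _ _)%:R - _).
set S := \sum_(_ <= _ < _) block_sum _ _ _ ^+ _ => FS kF.
have QS : `|(Q * normal_moment m * k.+1)%:R - Q%:R * S| <= 4 * k.+1%:R.
  have := ler_normD ((Q * normal_moment m * k.+1)%:R - F) (F - Q%:R * S).
  by rewrite subrKA; move: kF; rewrite distrC; lra.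
apply: le_lt_trans Qe; rewrite ler_pdivlMr ?ltr0n//.
rewrite -(@ler_pM2r _ k.+1%:R) ?ltr0n//; apply: le_trans QS.
rewrite le_eqVlt; apply/orP; left; apply/eqP.
rewrite -[X in _ * X * _ = _](normr_nat R) -[X in _ * X = _](normr_nat R) -!normrM; congr `|_|.
by rewrite !natrM /nu; field; rewrite ?nat1r ?natr1 pnatr_eq0.
Qed.

(** * Moments of the normal and of the empirical distributions *)

Section normal_moments.
Context {R : realType}.
Local Notation mu := (@lebesgue_measure R).
Local Notation P := (normal_prob (0 : R) 1).
Local Notation phi := (@normal_pdf R 0 1).

(** The change of variables holds for the Radon-Nikodym derivative of [P], which
    is [phi] almost everywhere by uniqueness. *)
Lemma ge0_integral_normal_prob (f : R -> \bar R) :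
  measurable_fun [set: R] f -> (forall x, 0 <= f x)%E ->
  (\int[P]_x f x = \int[mu]_x (f x * (phi x)%:E))%E.
Proof.
move=> mf f0; have dom := normal_prob_dominates (0 : R) 1.
pose g := Radon_Nikodym_SigmaFinite.f P mu.
have ig : mu.-integrable setT g by exact: Radon_Nikodym_SigmaFinite.f_integrable.
have mg := measurable_int _ ig.
have mphi : measurable_fun setT (fun x => (phi x)%:E).
  by apply/measurable_EFinP; exact: measurable_normal_pdf.
rewrite -(Radon_Nikodym_SigmaFinite.change_of_variables dom)//.
apply: ae_eq_integral => //; try exact: emeasurable_funM.
apply: ae_eqe_mul2l; apply: integral_ae_eq => // E _ mE.
by rewrite -(Radon_Nikodym_SigmaFinite.f_integral dom).
Qed.

Lemma integral_normal_prob (f : R -> R) : measurable_fun [set: R] f ->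
  (\int[P]_x (f x)%:E = \int[mu]_x (f x * phi x)%:E)%E.
Proof.
move=> mf; have mf' : measurable_fun [set: R] (EFin \o f) by exact/measurable_EFinP.
rewrite integralE ge0_integral_normal_prob//; last exact: measurable_funepos.
rewrite ge0_integral_normal_prob//; last exact: measurable_funeneg.
rewrite [RHS]integralE; congr (_ - _)%E; apply: eq_integral => x _.
  rewrite !funeposE -!EFin_max -EFinM; congr EFin.
  by rewrite maxr_pMl ?mul0r// normal_pdf_ge0.
rewrite !funenegE -!EFinN -!EFin_max -EFinM; congr EFin.
by rewrite maxr_pMl ?mul0r ?mulNr// normal_pdf_ge0.
Qed.

Let phiE x : phi x = normal_peak 1 * expR (- (2^-1 * x ^+ 2)).
Proof.
rewrite normal_pdfE ?oner_neq0// /normal_fun subr0 expr1n.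
by congr (_ * expR _); field.
Qed.

(** [exp (- x^2 / 2) = exp (- 3 x^2 / 8) exp (- x^2 / 8)], and the first factor
    absorbs every power of [x]; the second is the normal density of standard
    deviation [2], up to a constant. *)
Lemma normal_pdf_tail m : exists2 K : R, 0 < K &
  forall x, `|x| ^+ m * phi x <= K * normal_pdf 0 2 x.
Proof.
pose A : R := (8 / 3) ^+ m.+1 * m.+1`!%:R.
have A0 : 0 < A by rewrite mulr_gt0 ?exprn_gt0// ?ltr0n ?fact_gt0; lra.
have n20 : (2 : R) != 0 by lra.
have p1 := normal_peak_gt0 (oner_neq0 R); have p2 := normal_peak_gt0 n20.
exists (normal_peak 1 / normal_peak 2 * (1 + A)).
  by rewrite mulr_gt0 ?divr_gt0//; lra.
move=> x; rewrite phiE (normal_pdfE _ n20) /normal_fun subr0.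
have -> : - x ^+ 2 / (2 ^+ 2 *+ 2) = - (8^-1 * x ^+ 2) :> R by field.
have -> : - (2^-1 * x ^+ 2) = - (3 / 8 * x ^+ 2) + - (8^-1 * x ^+ 2) by field.
rewrite expRD; set y := 3 / 8 * x ^+ 2; set e := expR (- (8^-1 * _)).
have y0 : 0 <= y by rewrite mulr_ge0 ?sqr_ge0//; lra.
have xm : `|x| ^+ m <= 1 + (x ^+ 2) ^+ m.+1.
  rewrite -(@real_normK _ x) ?num_real// -exprM.
  have [x1|/ltW x1] := leP `|x| 1.
    by rewrite (le_trans (exprn_ile1 _ _ x1))// lerDl exprn_ge0.
  rewrite (@le_trans _ _ (`|x| ^+ (2 * m.+1)))// ?lerDr//.
  by rewrite ler_weXn2l//; lia.
have xA : (x ^+ 2) ^+ m.+1 <= A * (expR y - 1).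
  have -> : x ^+ 2 = 8 / 3 * y by rewrite /y; field.
  have c0 : 0 < (8 / 3 : R) ^+ m.+1 by apply: exprn_gt0; lra.
  rewrite exprMn /A -[leRHS]mulrA ler_pM2l//.
  rewrite mulrC -ler_pdivrMr ?ltr0n ?fact_gt0//.
  by rewrite lerBrDl expR_ge1Dxn.
have {}xm : `|x| ^+ m <= (1 + A) * expR y.
  apply: (le_trans xm); apply: (le_trans (lerD (lexx _) xA)).
  have : 1 <= expR y by rewrite -expR0 ler_expR.
  lra.
have -> : `|x| ^+ m * (normal_peak 1 * (expR (- y) * e)) =
  (`|x| ^+ m * expR (- y)) * (normal_peak 1 * e) by ring.
have -> : normal_peak 1 / normal_peak 2 * (1 + A) * (normal_peak 2 * e) =
  (1 + A) * (normal_peak 1 * e) by field; rewrite gt_eqF.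
rewrite ler_wpM2r ?mulr_ge0 ?expR_ge0 ?(ltW p1)//.
by rewrite expRN ler_pdivrMr ?expR_gt0.
Qed.

Lemma integrable_pow_normal_pdf m :
  mu.-integrable setT (fun x => (x ^+ m * phi x)%:E).
Proof.
have [K K0 xK] := normal_pdf_tail m.
refine (@le_integrable _ _ R mu setT measurableT _
  (fun x => K%:E * (normal_pdf 0 2 x)%:E)%E _ _ _).
- apply/measurable_EFinP; apply: measurable_funM; first exact: exprn_measurable.
  exact: measurable_normal_pdf.
- move=> x _ /=; rewrite lee_fin normrM normrX (ger0_norm (normal_pdf_ge0 _ _ _)).
  by rewrite (le_trans (xK x))// ler_norm.
- by apply: integrableZl => //; exact: integrable_normal_pdf.
Qed.

Let is_derive_phi (x : R) : is_derive x (1 : R) phi (- x * phi x).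
Proof.
have -> : phi = (fun x => normal_peak 1 * expR (- (2^-1 * x ^+ 2))).
  exact/funext/phiE.
apply: is_derive_eq.
by rewrite /GRing.scale /=; field.
Qed.

Let is_derive_ibp m (x : R) : is_derive x (1 : R) (fun y => - (y ^+ m * phi y))
  (x ^+ m.+1 * phi x - m%:R * x ^+ m.-1 * phi x).
Proof.
have dphi := is_derive_phi x.
have dX : is_derive x (1 : R) (fun y : R => y ^+ m) (m%:R * x ^+ m.-1).
  apply: DeriveDef; first exact: exprn_derivable.
  by rewrite exp_derive /GRing.scale /= mulr1.
by apply: is_derive_eq; rewrite /GRing.scale /= exprS; ring.
Qed.

(** The integrand is the derivative of [- x^m phi x], which vanishes at both
    infinities. *)
Let mean_zero m :
  (\int[mu]_x (x ^+ m.+1 * phi x - m%:R * x ^+ m.-1 * phi x)%:E = 0)%E.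
Proof.
pose h x := x ^+ m.+1 * phi x - m%:R * x ^+ m.-1 * phi x.
pose H x := - (x ^+ m * phi x).
pose h_ n := (EFin \o h) \_ `[- n%:R, n%:R]%classic.
have dH (x : R) : is_derive x (1 : R) H (h x) := is_derive_ibp m x.
have cont (f : R -> R) : (forall x, derivable f x 1) -> continuous f.
  by move=> df x; apply/differentiable_continuous/derivable1_diffP/df.
have ch : continuous h.
  apply: cont => x; rewrite /h; apply: derivableB; apply: derivableM.
  all: try exact: ex_derive.
  - exact: exprn_derivable.
  - by apply: derivableM; [exact: derivable_cst|exact: exprn_derivable].
have ih : mu.-integrable setT (EFin \o h).
  have -> : EFin \o h = ((fun x => (x ^+ m.+1 * phi x)%:E) \-
      (fun x => m%:R%:E * (x ^+ m.-1 * phi x)%:E))%E.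
    by apply/funext => x; rewrite /h [LHS]/= -mulrA EFinB EFinM.
  apply: (integrableB _ (integrable_pow_normal_pdf _)) => //.
  by apply: integrableZl => //; exact: integrable_pow_normal_pdf.
have mh := measurable_int _ ih.
have ftc n : (0 < n)%N -> (\int[mu]_x h_ n x = (H n%:R - H (- n%:R))%:E)%E.
  move=> n0; rewrite -integral_mkcond EFinB; apply: continuous_FTC2.
  - by rewrite (@lt_le_trans _ _ 0)// oppr_lt0 ltr0n.
  - exact/continuous_subspaceT.
  - have cH : continuous H by apply: cont => x; exact: ex_derive.
    split=> [x _||]; first exact: ex_derive.
      by apply: cvg_at_right_filter; exact: cH.
    by apply: cvg_at_left_filter; exact: cH.
  - by move=> x _; rewrite derive1E derive_val.
have mh_ n : measurable_fun setT (h_ n).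
  apply/(measurable_restrictT _ _).1; first exact: measurable_itv.
  exact: measurable_funTS.
have h_h x : h_ n x @[n --> \oo] --> (EFin \o h) x.
  apply: cvg_near_cst; near=> n; rewrite /h_ patchE mem_set//=.
  rewrite in_itv /= -ler_norml; near: n; exact: nbhs_infty_ger.
have h_le n x : (`|h_ n x| <= `|(h x)%:E|)%E.
  by rewrite /h_ patchE; case: ifP => // _; rewrite abse0 abse_ge0.
have ae_h : {ae mu, forall x, setT x -> h_^~ x @ \oo --> (EFin \o h) x}.
  by apply: aeW => x _; exact: h_h.
have ae_le : {ae mu, forall x n, setT x -> (`|h_ n x| <= `|(h x)%:E|)%E}.
  by apply: aeW => x n _; exact: h_le.
have [_ _ lim] := @dominated_convergence _ _ R mu setT measurableT h_ (EFin \o h)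
  (fun x => `|(h x)%:E|)%E mh_ mh ae_h (integrable_abse ih) ae_le.
have [K K0 xK] := normal_pdf_tail m.+1; pose C := K * normal_peak 2.
have HC (x : R) : x != 0 -> `|H x| <= C * `|x|^-1.
  move=> x0; rewrite ler_pdivlMr ?normr_gt0// /H normrN normrM normrX.
  rewrite (ger0_norm (normal_pdf_ge0 _ _ _)) mulrAC -exprSr (le_trans (xK x))//.
  by rewrite ler_wpM2l ?(ltW K0)// normal_pdf_ub// pnatr_eq0.
have H0 : H n%:R - H (- n%:R) @[n --> \oo] --> 0.
  apply/cvgr0Pnorm_le => e e0; near=> n.
  have n0 : (0 < n)%N by near: n; exact: nbhs_infty_gt.
  have nR : (n%:R : R) != 0 by rewrite pnatr_eq0 -lt0n.
  rewrite (le_trans (ler_normB _ _))//.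
  have := HC n%:R nR; have := HC (- n%:R).
  rewrite oppr_eq0 (normrN n%:R) normr_nat => /(_ nR).
  have : C * n%:R^-1 <= e / 2.
    rewrite ler_pdivrMr ?ltr0n// -ler_pdivrMl ?divr_gt0//.
    by near: n; exact: nbhs_infty_ger.
  lra.
have lim0 : [sequence (\int[mu]_x h_ n x)%E]_n @ \oo --> 0%E.
  have hE : \forall n \near \oo, (\int[mu]_x h_ n x = (H n%:R - H (- n%:R))%:E)%E.
    by near=> n; apply: ftc; near: n; exact: nbhs_infty_gt.
  apply: cvg_EFin; first by apply: filterS hE => n /= ->.
  by apply: cvg_trans H0; apply: near_eq_cvg; apply: filterS hE => n /= ->.
exact: (cvg_unique _ lim lim0).
Unshelve. all: by end_near. Qed.

Lemma integral_pow_normal_pdf m :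
  (\int[mu]_x (x ^+ m * phi x)%:E = ((normal_moment m)%:R)%:E)%E.
Proof.
elim/ltn_ind: m => -[_|m IHm].
  by under eq_integral do rewrite expr0 mul1r; rewrite integral_normal_pdf.
have i1 := integrable_pow_normal_pdf m.+1.
have i2 := integrable_pow_normal_pdf m.-1.
have i3 : mu.-integrable setT (fun x => m%:R%:E * (x ^+ m.-1 * phi x)%:E)%E.
  by apply: integrableZl.
have := integralB measurableT i1 i3.
rewrite [X in X = _ -> _](_ : _ = 0%E); last first.
  rewrite -[RHS](mean_zero m); apply: eq_integral => x _.
  by rewrite -mulrA EFinB (EFinM m%:R).
rewrite integralZl// => /esym.
rewrite (IHm m.-1) ?(leq_ltn_trans (leq_pred m))// normal_momentS natrM.
have := integrable_fin_num measurableT i1.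
case: (\int[mu]_x _)%E => [r _| |]//; rewrite -EFinM -EFinB.
by case=> /subr0_eq ->.
Qed.

Lemma integrable_pow_normal_prob m :
  P.-integrable setT (fun x : R => (x ^+ m)%:E).
Proof.
have mX : measurable_fun [set: R] (fun x : R => (x ^+ m)%:E).
  by apply/measurable_EFinP; exact: exprn_measurable.
apply/integrableP; split => //.
rewrite ge0_integral_normal_prob//; last exact: measurableT_comp.
have /integrableP[_] := integrable_pow_normal_pdf m.
congr (_ < _)%E; apply: eq_integral => x _.
by rewrite /= -EFinM normrM (ger0_norm (normal_pdf_ge0 _ _ _)).
Qed.

Lemma expectation_pow_normal_prob m :
  ('E_P[fun x : R => (x ^+ m)%R] = ((normal_moment m)%:R)%:E)%E.
Proof.
by rewrite unlock integral_normal_prob ?integral_pow_normal_pdf.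
Qed.

(** The density is bounded, so the distribution function is Lipschitz. *)
Lemma normal_cdf_lipschitz (s t : R) : s <= t ->
  normal_cdf s <= normal_cdf t <= normal_cdf s + normal_peak 1 * (t - s).
Proof.
move=> st; have fin (A : set (measurableTypeR R)) : measurable A -> P A \is a fin_num.
  exact: fin_num_measure.
have -> : normal_cdf t = normal_cdf s + fine (P `]s, t]%classic).
  rewrite /normal_cdf -fineD ?fin//; congr fine; rewrite -measureU//.
    by congr (P _); rewrite -itv_bndbnd_setU.
  by rewrite -subset0 => x [] /=; rewrite !in_itv/= => xs; rewrite ltNge xs.
rewrite lerDl lerD2l fine_ge0//= -lee_fin fineK ?fin//.
apply: (@le_trans _ _ (\int[mu]_(x in `]s, t]) (normal_peak 1)%:E)%E).
  apply: ge0_le_integral => //.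
  - by move=> x _; rewrite lee_fin normal_pdf_ge0.
  - by apply/measurable_EFinP/measurable_funTS; exact: measurable_normal_pdf.
  - by move=> x _; rewrite lee_fin normal_pdf_ub// oner_neq0.
rewrite integral_cst//= lebesgue_measure_itv/= lte_fin.
case: ltP => [_|ts]; first by rewrite -EFinB.
by rewrite mule0 lee_fin mulr_ge0 ?subr_ge0// normal_peak_ge0.
Qed.

End normal_moments.

(** Integrals with respect to a sum of Dirac masses are computed for nonnegative
    functions first, then applied to the positive and negative parts of [f]. *)
Lemma expectation_empirical (R : realType) (s : nat -> R) k (f : R -> R) :
  (0 < k)%N -> measurable_fun [set: R] f ->
  ('E_(empirical s k)[f] = (k%:R^-1 * \sum_(1 <= i < k.+1) f (s i))%:E)%E.
Proof.
move=> k0 mf.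
pose m := [the {measure set (measurableTypeR R) -> \bar R} of
  msum (fun i => \d_(s i.+1 : measurableTypeR R)) k].
have kn : (0 : R) <= k%:R^-1 by rewrite invr_ge0.
have eE (A : set (measurableTypeR R)) : measurable A ->
    empirical s k A = mscale (NngNum kn) m A.
  move=> mA.
  have mT : m [set: measurableTypeR R] = (k%:R)%:E.
    rewrite /m /= /msum (eq_bigr (fun=> 1%E)) => [|i _]; last exact: diracT.
    by rewrite sumEFin sumr_const card_ord.
  transitivity (mnormalize m \d_(0 : measurableTypeR R) A) => //.
  by rewrite /mnormalize mT orbF eqe pnatr_eq0 eqn0Ngt k0 /= muleC.
have ge0E (g : R -> \bar R) : measurable_fun [set: R] g -> (forall x, 0 <= g x)%E ->
    (\int[empirical s k]_x g x = (k%:R^-1)%:E * \sum_(i < k) g (s i.+1))%E.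
  move=> mg g0; rewrite (eq_measure_integral (mscale (NngNum kn) m)); last first.
    by move=> A mA _; exact: eE.
  rewrite ge0_integral_mscale//= ge0_integral_measure_sum//; congr (_ * _)%E.
  by apply: eq_bigr => i _; rewrite integral_dirac//= diracT mul1e.
rewrite unlock integralE; have mf' : measurable_fun [set: R] (EFin \o f).
  exact/measurable_EFinP.
rewrite !ge0E//; try by [exact: measurable_funepos | exact: measurable_funeneg].
under eq_bigr do rewrite funeposE -EFin_max.
under [X in (_ - _ * X)%E]eq_bigr do rewrite funenegE -EFinN -EFin_max.
rewrite !sumEFin -!EFinM -EFinB -mulrBr -sumrB big_add1 /= big_mkord.
congr (_ * _)%:E; apply: eq_bigr => i _.
by rewrite /Num.max; case: ifP; case: ifP; lra.
Qed.

(** * Taylor polynomials of the cosine *)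

Section taylor_cos.
Context {R : realType}.
Implicit Types (a b x y : R) (n : nat).

(** The Taylor polynomial of [x |-> cos (a x + b)] at [0]. *)
Definition taylor_cos n a b y : R :=
  \sum_(j < n) (a ^+ j * cos (b + (pi / 2) *+ j) / j`!%:R) * y ^+ j.

Let is_derive_cos_affine a b x :
  is_derive x (1 : R) (fun y => cos (a * y + b)) (a * cos (a * x + (b + pi / 2))).
Proof.
apply: is_derive_eq.
by rewrite /GRing.scale /= addrA cosDpihalf; ring.
Qed.

Let is_derive_taylor_cos n a b x :
  is_derive x (1 : R) (taylor_cos n.+1 a b) (a * taylor_cos n a (b + pi / 2) x).
Proof.
pose c j := a ^+ j * cos (b + (pi / 2) *+ j) / j`!%:R.
have -> : taylor_cos n.+1 a b = \sum_(j < n.+1) (fun y => c j * y ^+ j).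
  by apply/funext => y; rewrite fct_sumE.
have dc (j : nat) : is_derive x (1 : R) (fun y => c j * y ^+ j) (c j * (j%:R * x ^+ j.-1)).
  have dX : is_derive x (1 : R) (fun y : R => y ^+ j) (j%:R * x ^+ j.-1).
    apply: DeriveDef; first exact: exprn_derivable.
    by rewrite exp_derive /GRing.scale /= mulr1.
  by apply: is_derive_eq; rewrite /GRing.scale /=; ring.
have := @is_derive_sum _ _ _ _ _ x (1 : R) _ (fun j : 'I_n.+1 => dc j).
congr (is_derive _ _ _ _); rewrite big_ord_recl /= mul0r mulr0 add0r.
rewrite /taylor_cos mulr_sumr; apply: eq_bigr => j _.
rewrite /c /bump /= add1n exprS factS natrM mulrSr addrAC addrA.
field; by rewrite !pnatr_eq0 -lt0n fact_gt0 /= nat1r pnatr_eq0.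
Qed.

(** The derivative of the remainder of order [n + 1] is [a] times the remainder of
    order [n] for the phase [b + pi / 2]; the bound follows by integration, that
    is, by monotonicity of [B + g] and [B - g] in the induction step. *)
Let taylor_cos_ge0 n a b x : 0 <= x ->
  `|cos (a * x + b) - taylor_cos n a b x| <= `|a| ^+ n * x ^+ n / n`!%:R.
Proof.
move=> x0; elim: n b x x0 => [|n IHn] b x x0.
  by rewrite /taylor_cos big_ord0 subr0 !expr0 fact0 mul1r divr1 cos_max.
pose g y := cos (a * y + b) - taylor_cos n.+1 a b y.
pose dg y := a * (cos (a * y + (b + pi / 2)) - taylor_cos n a (b + pi / 2) y).
have gd y : is_derive y (1 : R) g (dg y).
  have h1 := is_derive_cos_affine a b y; have h2 := is_derive_taylor_cos n a b y.
  by apply: is_derive_eq; rewrite /dg mulrBr.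
have g0 : g 0 = 0.
  rewrite /g /taylor_cos mulr0 add0r big_ord_recl /= expr0 mul1r expr0 mulr1.
  rewrite mulr0n addr0 fact0 divr1 big1 ?addr0 ?subrr// => i _.
  by rewrite expr0n mulr0.
pose B y := `|a| ^+ n.+1 * y ^+ n.+1 / n.+1`!%:R : R.
pose dB y := `|a| ^+ n.+1 * y ^+ n / n`!%:R : R.
have Bd (y : R) : is_derive y (1 : R) B (dB y).
  have dX : is_derive y (1 : R) (fun z : R => z ^+ n.+1) (n.+1%:R * y ^+ n).
    apply: DeriveDef; first exact: exprn_derivable.
    by rewrite exp_derive /GRing.scale /= mulr1.
  apply: is_derive_eq; rewrite /dB /GRing.scale /= factS natrM.
  field; by rewrite !pnatr_eq0 -lt0n fact_gt0 /= ?nat1r ?pnatr_eq0.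
have gB y : 0 <= y -> `|dg y| <= dB y.
  move=> y0; rewrite /dg /dB normrM exprS -!mulrA ler_wpM2l// mulrA.
  exact: IHn.
have incr (h dh : R -> R) : (forall y : R, is_derive y (1 : R) h (dh y)) ->
    (forall y, 0 <= y -> 0 <= dh y) -> h 0 <= h x.
  move=> hd dh0; have ch : continuous h.
    by move=> y; apply/differentiable_continuous/derivable1_diffP/ex_derive.
  have [y] := MVT_segment x0 (fun y _ => hd y) (continuous_subspaceT ch).
  rewrite in_itv/= => /andP[y0 _] E; rewrite -subr_ge0 E subr0.
  by rewrite mulr_ge0// dh0.
have B0 : B 0 = 0 by rewrite /B expr0n mulr0 mul0r.
rewrite -/(g x) -/(B x) ler_norml; apply/andP; split.
  have := incr (fun y => B y + g y) (fun y => dB y + dg y).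
  rewrite B0 g0 addr0 -lerBlDl sub0r; apply.
  by move=> y /gB; rewrite ler_norml; lra.
have := incr (fun y => B y - g y) (fun y => dB y - dg y).
rewrite B0 g0 subr0 subr_ge0; apply.
  by move=> y /gB; rewrite ler_norml; lra.
Qed.

Lemma taylor_cos_le n a b x :
  `|cos (a * x + b) - taylor_cos n a b x| <= `|a| ^+ n * `|x| ^+ n / n`!%:R.
Proof.
have [x0|/ltW x0] := leP 0 x; first by rewrite (ger0_norm x0) taylor_cos_ge0.
have -> : taylor_cos n a b x = taylor_cos n (- a) b (- x).
  apply: eq_bigr => j _; rewrite (exprNn a) (exprNn x).
  have sq : (-1) ^+ j * (-1) ^+ j = 1 :> R by rewrite -expr2 sqrr_sign.
  rewrite -[LHS]mul1r -{1}sq.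
  by field; rewrite pnatr_eq0 -lt0n fact_gt0.
rewrite -mulrNN -(normrN a) (ler0_norm x0); apply: taylor_cos_ge0.
by rewrite oppr_ge0.
Qed.

End taylor_cos.

(** * Polynomial approximation of a step *)

Section step_function.
Context {R : realType}.
Implicit Types (p s u x : R) (n : nat).

Let bernoulli_ge u n : 0 <= u -> 1 + n%:R * u <= (1 + u) ^+ n.
Proof.
move=> u0; elim: n => [|n IHn]; first by rewrite mul0r addr0.
rewrite exprS -(natr1 n); apply: le_trans (ler_wpM2l _ IHn); last by lra.
have : 0 <= n%:R * u * u by rewrite !mulr_ge0.
by nra.
Qed.

Let bernoulli_le u n : 0 <= u <= 1 -> 1 - n%:R * u <= (1 - u) ^+ n.
Proof.
move=> /andP[u0 u1]; elim: n => [|n IHn]; first by rewrite mul0r subr0.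
rewrite exprS -(natr1 n); apply: le_trans (ler_wpM2l _ IHn); last by lra.
have : 0 <= n%:R * u * u by rewrite !mulr_ge0.
by nra.
Qed.

(** With [p = (1 + y) / 2], this is [(1 - p^n)^(2^n)]. By Bernoulli's inequality it
    is at least [1 - (2 p)^n] and at most [1 / (2 p)^n], hence the transition at
    [p = 1/2], that is, at [y = 0]. *)
Definition step_poly n : {poly R} := (1 - (2^-1 *: (1 + 'X)) ^+ n) ^+ (2 ^ n).

Let stepE n y : (step_poly n).[y] = (1 - (2^-1 * (1 + y)) ^+ n) ^+ (2 ^ n).
Proof. by rewrite /step_poly !hornerE. Qed.

Let step_01 n y : -1 <= y <= 1 -> 0 <= (step_poly n).[y] <= 1.
Proof.
move=> y1; rewrite stepE; set p := 2^-1 * _.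
have p01 : 0 <= p <= 1 by rewrite /p; lra.
have pn : 0 <= p ^+ n <= 1.
  by case/andP: p01 => p0 p1; rewrite exprn_ge0// exprn_ile1.
by rewrite exprn_ge0 ?exprn_ile1//; lra.
Qed.

Let step_ge n s y : 0 <= s -> -1 <= y <= - s -> 1 - (1 - s) ^+ n <= (step_poly n).[y].
Proof.
move=> s0 /andP[y1 ys]; rewrite stepE; set p := 2^-1 * _.
have p0 : 0 <= p by rewrite /p; lra.
have ps : 2 * p <= 1 - s by rewrite /p; lra.
have pn : 0 <= p ^+ n <= 1 by rewrite exprn_ge0// exprn_ile1// /p; lra.
apply: le_trans (bernoulli_le (2 ^ n) pn); rewrite lerD2l lerN2 natrX -exprMn.
by rewrite lerXn2r// nnegrE; lra.
Qed.

Let step_le n s y : 0 <= s -> s <= y <= 1 -> (step_poly n).[y] <= (1 + s)^-1 ^+ n.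
Proof.
move=> s0 /andP[ys y1]; rewrite stepE; set p := 2^-1 * _.
have p0 : 0 <= p by rewrite /p; lra.
have ps : 1 + s <= 2 * p by rewrite /p; lra.
have /andP[pn0 pn1] : 0 <= p ^+ n <= 1.
  by rewrite exprn_ge0// exprn_ile1// /p; lra.
rewrite exprVn -[leRHS]mul1r ler_pdivlMr; last by apply: exprn_gt0; lra.
apply: (@le_trans _ _ ((1 - p ^+ n) ^+ (2 ^ n) * (1 + p ^+ n) ^+ (2 ^ n))).
  apply: ler_wpM2l; first by rewrite exprn_ge0 ?subr_ge0.
  apply: (le_trans _ (bernoulli_ge (2 ^ n) pn0)).
  apply: (@le_trans _ _ (2 ^+ n * p ^+ n)); last by rewrite natrX lerDr.
  by rewrite -exprMn lerXn2r// nnegrE; lra.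
rewrite -exprMn -subr_sqr expr1n exprn_ile1//.
  by rewrite subr_ge0 exprn_ile1.
by rewrite gerBl sqr_ge0.
Qed.

(** Both errors in Bernoulli's inequality are powers of numbers below [1], namely
    of [1 - s] and of [1 / (1 + s)]. *)
Lemma step_poly_approx s e : 0 < s <= 1 -> 0 < e -> exists n,
  [/\ forall y, -1 <= y <= 1 -> 0 <= (step_poly n).[y] <= 1,
      forall y, -1 <= y <= - s -> 1 - e <= (step_poly n).[y] &
      forall y, s <= y <= 1 -> (step_poly n).[y] <= e].
Proof.
move=> /andP[s0 s1] e0.
have small z : `|z| < 1 -> \forall n \near \oo, z ^+ n <= e.
  move=> /cvg_expr/cvgrPdist_le/(_ _ e0); apply: filterS => n.
  by rewrite sub0r normrN; apply: le_trans (ler_norm _).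
have h1 : `|1 - s| < 1 by rewrite ger0_norm; lra.
have h2 : `|(1 + s)^-1| < 1.
  by rewrite ger0_norm ?invr_ge0 ?invf_lt1; lra.
near \oo => n; exists n; split=> y yy; first exact: step_01.
  apply: le_trans (step_ge n (ltW s0) yy); rewrite lerD2l lerN2.
  by near: n; exact: small.
apply: (le_trans (step_le n (ltW s0) yy)).
by near: n; exact: small.
Unshelve. all: by end_near. Qed.

Lemma ler_sin_arc x y : 0 <= x -> x <= y <= pi - x -> sin x <= sin y.
Proof.
move=> x0 /andP[xy yx]; have pi0 := pi_gt0 R.
have -> : sin y = sin ((y + x) / 2 + (y - x) / 2) by congr sin; field.
have -> : sin x = sin ((y + x) / 2 - (y - x) / 2) by congr sin; field.
rewrite sinB sinD -subr_ge0 [X in 0 <= X](_ : _ =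
  2 * (cos ((y + x) / 2) * sin ((y - x) / 2))); last by ring.
rewrite mulr_ge0// mulr_ge0//; first by apply: cos_ge0_pihalf; lra.
by apply: sin_ge0_pi; lra.
Qed.

End step_function.

(** * The method of moments *)

Section moment_method.
Context {R : realType}.
Variables (P : probability (measurableTypeR R) R) (X : nat -> R) (nu : nat -> R).

(** Expectations under the empirical distribution and under its limit. *)
Let avg (f : R -> R) k : R := k%:R^-1 * \sum_(1 <= i < k.+1) f (X i).
Let mean (f : R -> R) : R := \int[P]_x f x.
Let integrable (f : R -> R) := P.-integrable [set: measurableTypeR R] (EFin \o f).

Hypothesis iX : forall m, integrable (fun x => x ^+ m).
Hypothesis mean_pow : forall m, mean (fun x => x ^+ m) = nu m.
Hypothesis avg_pow : forall m, avg (fun x => x ^+ m) k @[k --> \oo] --> nu m.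
Hypothesis nu_growth : forall a : R,
  a ^+ (2 * n) * nu (2 * n)%N / (2 * n)`!%:R @[n --> \oo] --> (0 : R).

(** The functions along which the empirical distributions converge to [P]. *)
Let test f := integrable f /\ avg f k @[k --> \oo] --> mean f.

Let avgD f g k : avg (fun x => f x + g x) k = avg f k + avg g k.
Proof. by rewrite /avg big_split mulrDr. Qed.

Let avgZ a f k : avg (fun x => a * f x) k = a * avg f k.
Proof. by rewrite /avg -mulr_sumr mulrCA. Qed.

Let ler_avg f g k : (forall x, f x <= g x) -> avg f k <= avg g k.
Proof. by move=> fg; rewrite ler_wpM2l ?invr_ge0// ler_sum. Qed.

Let ler_mean f g : integrable f -> integrable g -> (forall x, f x <= g x) ->
  mean f <= mean g.
Proof. by move=> mf mg fg; apply: le_Rintegral. Qed.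

Let integrableD f g : integrable f -> integrable g ->
  integrable (fun x => f x + g x).
Proof. by move=> mf mg; apply: (integrableD measurableT mf mg). Qed.

Let integrableZ a f : integrable f -> integrable (fun x => a * f x).
Proof. by move=> mf; apply: (integrableZl measurableT a mf). Qed.

Let meanD f g : integrable f -> integrable g ->
  mean (fun x => f x + g x) = mean f + mean g.
Proof. by move=> mf mg; exact: RintegralD. Qed.

Let meanZ a f : integrable f -> mean (fun x => a * f x) = a * mean f.
Proof. by move=> mf; exact: RintegralZl. Qed.

Let integrable_bounded (f : R -> R) (M : R) : continuous f -> (forall x, `|f x| <= M) ->
  integrable f.
Proof.
move=> cf fM; apply: measurable_bounded_integrable => //.
- by rewrite (le_lt_trans (probability_le1 _ _))// ltry.
- exact: continuous_measurable_fun.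
- by exists M; split=> [|y My x _ /=]; [exact: num_real|exact: le_trans (fM x) (ltW My)].
Qed.

Let testD f g : test f -> test g -> test (fun x => f x + g x).
Proof.
move=> [mf cf] [mg cg]; split; first exact: integrableD.
rewrite meanD//; under eq_fun do rewrite avgD; exact: cvgD.
Qed.

Let testZ a f : test f -> test (fun x => a * f x).
Proof.
move=> [mf cf]; split; first exact: integrableZ.
rewrite meanZ//; under eq_fun do rewrite avgZ; exact: cvgMl_tmp.
Qed.

Let test_pow m : test (fun x => x ^+ m).
Proof. by split; [exact: iX | rewrite mean_pow]. Qed.

Let test_cst a : test (fun=> a).
Proof.
rewrite (_ : (fun=> a) = (fun x => a * x ^+ 0)); first exact: testZ.
by apply/funext => x; rewrite mulr1.
Qed.

Let test_sum (I : Type) (s : seq I) (F : I -> R -> R) :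
  (forall i, test (F i)) -> test (fun x => \sum_(i <- s) F i x).
Proof.
move=> tF; elim: s => [|i s IHs].
  by under eq_fun do rewrite big_nil; exact: test_cst.
by under eq_fun do rewrite big_cons; exact: testD.
Qed.

(** The error bound must be a test function too: a small mean then makes its
    empirical averages small. *)
Let test_approx f : integrable f -> (forall e, 0 < e ->
    exists g h, [/\ test g, test h, forall x, `|f x - g x| <= h x & mean h <= e]) ->
  test f.
Proof.
move=> mf fapprox; split => //; apply/cvgrPdist_le => e e0.
have e4 : 0 < e / 4 by lra.
have [g [h [[mg cg] [mh ch] fgh he]]] := fapprox _ e4.
have fg_mean : `|mean f - mean g| <= mean h.
  have := ler_mean mf (integrableD mg mh); have := ler_mean mg (integrableD mf mh).
  rewrite !meanD// ler_norml => h1 h2.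
  have {}h1 : mean g <= mean f + mean h.
    by apply: h1 => x; have := fgh x; rewrite ler_norml; lra.
  have {}h2 : mean f <= mean g + mean h.
    by apply: h2 => x; have := fgh x; rewrite ler_norml; lra.
  by lra.
have fg_avg k : `|avg f k - avg g k| <= avg h k.
  rewrite ler_norml; apply/andP; split.
    rewrite lerBrDl lerBlDr -avgD; apply: ler_avg => x.
    by have := fgh x; rewrite ler_norml; lra.
  rewrite lerBlDr -avgD; apply: ler_avg => x.
  by have := fgh x; rewrite ler_norml; lra.
near=> k.
have hk : `|mean h - avg h k| <= e / 4 by near: k; move/cvgrPdist_le: ch; apply.
have gk : `|mean g - avg g k| <= e / 4 by near: k; move/cvgrPdist_le: cg; apply.
have := fg_avg k; move: hk gk fg_mean; rewrite !ler_norml; lra.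
Unshelve. all: by end_near. Qed.

(** The error of a Taylor polynomial is bounded by a single even power, whose
    mean is small by the growth condition. *)
Let test_cos a b : test (fun x => cos (a * x + b)).
Proof.
apply: test_approx.
  apply: (integrable_bounded (M := 1)); last by move=> x; exact: cos_max.
  move=> x; apply: (@continuous_comp _ _ _ (fun x => a * x + b) cos).
    by apply: cvgD; [exact: mulrl_continuous|exact: cvg_cst].
  exact: continuous_cos.
move=> e e0; have /cvgrPdist_le/(_ _ e0)[n _ /(_ n (leqnn n))/=] := nu_growth a.
rewrite sub0r normrN => /(le_trans (ler_norm _)) ne.
exists (taylor_cos (2 * n) a b).
exists (fun x => a ^+ (2 * n) / (2 * n)`!%:R * x ^+ (2 * n)); split.
- by apply: test_sum => j; exact/testZ/test_pow.
- exact/testZ/test_pow.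
- move=> x; apply: (le_trans (taylor_cos_le _ _ _ _)).
  rewrite -!normrX !ger0_norm ?exprn_even_ge0 ?mul2n ?odd_double//.
  by rewrite mulrAC.
- by rewrite meanZ// mean_pow mulrAC.
Qed.

(** The product formula for cosines lowers the power by one; a second cosine
    factor makes the statement inductive. *)
Let test_cosM j a b c d : test (fun x => cos (c * x + d) * cos (a * x + b) ^+ j).
Proof.
elim: j c d => [|j IHj] c d; first by under eq_fun do rewrite mulr1; exact: test_cos.
have -> : (fun x => cos (c * x + d) * cos (a * x + b) ^+ j.+1) = (fun x =>
    2^-1 * (cos ((c + a) * x + (d + b)) * cos (a * x + b) ^+ j) +
    2^-1 * (cos ((c - a) * x + (d - b)) * cos (a * x + b) ^+ j)).
  apply/funext => x; rewrite exprS.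
  have -> : (c + a) * x + (d + b) = (c * x + d) + (a * x + b) by ring.
  have -> : (c - a) * x + (d - b) = (c * x + d) - (a * x + b) by ring.
  by move: (c * x + d) (a * x + b) => u v; rewrite cosB cosD; field.
by apply: testD; apply: testZ.
Qed.

Let test_poly_cos (p : {poly R}) a b : test (fun x => p.[cos (a * x + b)]).
Proof.
under eq_fun do rewrite horner_coef.
apply: test_sum => j; apply: testZ.
have -> : (fun x => cos (a * x + b) ^+ j) =
    (fun x => cos (0 * x + 0) * cos (a * x + b) ^+ j).
  by apply/funext => x; rewrite mul0r addr0 cos0 mul1r.
exact: test_cosM.
Qed.

Let below (t x : R) : R := (x <= t)%R%:R.

(** A trigonometric polynomial of large period follows the step at [t] on one
    period; the quadratic term takes over outside. *)
Let below_sandwich t d e : 0 < d -> 0 < e -> exists h, [/\ test h,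
  forall x, below t x <= h x &
  forall x, h x <= below (t + d) x + e * (1 + x ^+ 2)].
Proof.
move=> d0 e0; pose d' := d / 2; pose c := t + d'; pose e' := e / 2.
have d'0 : 0 < d' by rewrite /d'; lra.
have e'0 : 0 < e' by rewrite /e'; lra.
pose L := `|c| + 2 * d' + 1 + e'^-1.
have e'V : 0 < e'^-1 by rewrite invr_gt0.
have Lc : `|c| + 2 * d' + 1 <= L by rewrite /L; lra.
have L0 : 0 < L by have := normr_ge0 c; lra.
have far x : L - `|c| - d' <= `|x| -> 1 <= e' * x ^+ 2.
  move=> xL; rewrite -(@real_normK _ x) ?num_real//.
  have x1 : 1 + e'^-1 <= `|x| by move: xL; rewrite /L; lra.
  have : e' * (1 + e'^-1) ^+ 2 <= e' * `|x| ^+ 2.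
    by rewrite ler_pM2l// lerXn2r// nnegrE; lra.
  have -> : e' * (1 + e'^-1) ^+ 2 = e' + 2 + e'^-1 by field; rewrite gt_eqF.
  by lra.
have pi0 := pi_gt0 R.
pose w := pi / L; have w0 : 0 < w by rewrite divr_gt0.
have wL : w * L = pi by rewrite /w divfK// gt_eqF.
pose y x := cos (w * x + (- (w * c) - pi / 2)).
have yE x : y x = sin (w * (x - c)).
  by rewrite /y -cosBpihalf; congr cos; ring.
pose s := sin (w * d').
have wd'0 : 0 < w * d' by rewrite mulr_gt0.
have wd'1 : w * d' <= pi / 2.
  by rewrite -wL -mulrA ler_pM2l//; have := normr_ge0 c; lra.
have s01 : 0 < s <= 1.
  by rewrite /s sin_le1 andbT sin_gt0_pi//; lra.
have [n [g01 g1 g0]] := step_poly_approx s01 e'0.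
have y1 x : -1 <= y x <= 1 by rewrite cos_geN1 cos_le1.
have wle u v : u <= v -> w * u <= w * v by move=> uv; rewrite ler_pM2l.
have yneg x : c - L + d' <= x -> x <= c - d' -> y x <= - s.
  move=> x1 x2; rewrite yE lerNr -sinN; apply: ler_sin_arc; first exact: ltW.
  have := wle d' (c - x); have := wle (c - x) (L - d').
  rewrite !mulrBr wL; lra.
have ypos x : c + d' <= x -> x <= c + L - d' -> s <= y x.
  move=> x1 x2; rewrite yE; apply: ler_sin_arc; first exact: ltW.
  have := wle d' (x - c); have := wle (x - c) (L - d').
  rewrite !mulrBr wL; lra.
pose g x := (step_poly n).[y x].
(* The constant term makes up for the error of [g] within the period. *)
exists (fun x => g x + (e' * x ^+ 0 + e' * x ^+ 2)); split.
- by apply: testD; [exact: test_poly_cos|apply: testD; exact/testZ/test_pow].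
- move=> x; rewrite expr0 mulr1.
  have /andP[gx0 gx1] := g01 _ (y1 x); have x20 := sqr_ge0 x.
  have ex2 : 0 <= e' * x ^+ 2 by rewrite mulr_ge0// ltW.
  rewrite /below; case: (leP x t) => /= [xt|_]; last by rewrite /g; lra.
  have [xL|xL] := leP (c - L + d') x.
    have : 1 - e' <= g x.
      apply: g1; rewrite yneg ?andbT//; first by have /andP[] := y1 x.
      by rewrite /c; lra.
    by lra.
  have : 1 <= e' * x ^+ 2.
    apply: far; have := ler_norm c; have := ler_norm (- x); rewrite normrN; lra.
  by rewrite /g; lra.
- move=> x; rewrite expr0 mulr1.
  have /andP[gx0 gx1] := g01 _ (y1 x); have x20 := sqr_ge0 x.
  have ex2 : 0 <= e' * x ^+ 2 by rewrite mulr_ge0// ltW.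
  have -> : e * (1 + x ^+ 2) = 2 * e' + 2 * (e' * x ^+ 2) by rewrite /e'; field.
  rewrite /below; case: (leP x (t + d)) => /= [xt|xt]; first by rewrite /g; lra.
  have [xL|xL] := leP x (c + L - d').
    have : g x <= e'.
      apply: g0; rewrite ypos ?andTb//; first by have /andP[] := y1 x.
      by rewrite /c /d'; lra.
    by lra.
  have : 1 <= e' * x ^+ 2.
    apply: far; have := ler_norm (- c); have := ler_norm x; rewrite normrN; lra.
  by rewrite /g; lra.
Qed.

Let F t : R := fine (P `]-oo, t]%classic).
Variable K : R.
Hypothesis F_lip : forall s t, s <= t -> F s <= F t <= F s + K * (t - s).

Let integrable_below t : integrable (below t) /\ mean (below t) = F t.
Proof.
have bE : below t = \1_(`]-oo, t]%classic : set R).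
  by apply/funext => x; rewrite /below indicE mem_setE in_itv.
have mt : measurable (`]-oo, t]%classic : set (measurableTypeR R)).
  exact: measurable_itv.
rewrite bE; split; last by rewrite /mean /Rintegral integral_indic// setIT.
apply: measurable_bounded_integrable => //.
- by rewrite (le_lt_trans (probability_le1 _ _))// ltry.
- exists 1; split=> [|y y1 x _ /=]; first exact: num_real.
  rewrite indicE (le_trans _ (ltW y1))//.
  by case: (_ \in _); rewrite ?normr1 ?normr0.
Qed.

Let K_ge0 : 0 <= K.
Proof. by have := @F_lip 0 1 ler01; lra. Qed.

Let q (x : R) : R := x ^+ 0 + x ^+ 2.

Let test_q : test q. Proof. by apply: testD; exact: test_pow. Qed.

Let avg_ge0 f k : (forall x, 0 <= f x) -> 0 <= avg f k.
Proof. by move=> f0; rewrite mulr_ge0 ?invr_ge0// sumr_ge0. Qed.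

Let mean_ge0 f : (forall x, 0 <= f x) -> 0 <= mean f.
Proof. by move=> f0; exact: Rintegral_ge0. Qed.

(** Sandwich the step at [t] between test functions that follow steps at [t - d]
    and [t + d]; their means are close to [F t] as [F] is Lipschitz. *)
Let cvg_below t : avg (below t) k @[k --> \oo] --> F t.
Proof.
have Kge0 := K_ge0; have [iq cq] := test_q; have C0 : 0 <= mean q.
  by apply: mean_ge0 => x; rewrite addr_ge0 ?exprn_even_ge0.
apply/cvgrPdist_le => e e0.
pose d := e / (4 * (K + 1)); pose n := e / (4 * (mean q + 1)).
have d0 : 0 < d by rewrite divr_gt0// mulr_gt0//; lra.
have n0 : 0 < n by rewrite divr_gt0// mulr_gt0//; lra.
have K1 : K + 1 != 0 by apply: lt0r_neq0; lra.
have q1 : mean q + 1 != 0 by apply: lt0r_neq0; lra.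
have Kd : K * d <= e / 4.
  have -> : e / 4 = (K + 1) * d by rewrite /d; field.
  by rewrite ler_pM2r//; lra.
have nq : n * (mean q + 1) = e / 4 by rewrite /n; field.
have [h [[ih ch] h1 h2]] := below_sandwich t d0 n0.
have [h' [[ih' ch'] h1' h2']] := below_sandwich (t - d) d0 n0.
have qE x : n * (1 + x ^+ 2) = n * q x by rewrite /q expr0.
have hF : mean h <= F t + K * d + n * mean q.
  have [ib <-] := integrable_below t; have [ib' bF] := integrable_below (t + d).
  apply: (@le_trans _ _ (mean (fun x => below (t + d) x + n * q x))).
    apply: (ler_mean ih (integrableD ib' (integrableZ n iq))) => x.
    by rewrite -qE.
  rewrite (meanD ib' (integrableZ n iq)) meanZ// lerD2r bF (integrable_below t).2.
  by have := @F_lip t (t + d); lra.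
have hF' : F t - K * d <= mean h'.
  have [ib bF] := integrable_below (t - d).
  have := ler_mean ib ih' h1'; rewrite bF.
  by have := @F_lip (t - d) t; lra.
near=> k.
have hk : `|mean h - avg h k| <= e / 4.
  by near: k; move/cvgrPdist_le: ch; apply; lra.
have hk' : `|mean h' - avg h' k| <= e / 4.
  by near: k; move/cvgrPdist_le: ch'; apply; lra.
have qk : `|mean q - avg q k| <= 1 by near: k; move/cvgrPdist_le: cq; apply.
have u := ler_avg k h1.
have l : avg h' k <= avg (below t) k + n * avg q k.
  rewrite -avgZ -avgD; apply: ler_avg => x; have := h2' x.
  by rewrite subrK qE.
have nqk : n * avg q k <= e / 4.
  by rewrite -nq ler_pM2l//; move: qk; rewrite ler_norml; lra.
have nq' : n * mean q <= e / 4 by rewrite -nq ler_pM2l//; lra.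
move: hk hk'; rewrite !ler_norml; lra.
Unshelve. all: by end_near. Qed.

Let mean1 : mean (fun=> 1) = 1.
Proof.
rewrite /mean Rintegral_cst// mul1r -[RHS]/(fine 1%E); congr fine.
exact: probability_setT.
Qed.

Let below_01 t x : 0 <= below t x <= 1.
Proof. by rewrite /below; case: (x <= t); rewrite ?lexx ?ler01. Qed.

Let below_le s t x : s <= t -> below s x <= below t x.
Proof.
move=> st; rewrite /below; case: (leP x s) => // xs.
by rewrite (le_trans xs st).
Qed.

Let F_01 t : 0 <= F t <= 1.
Proof.
have [ib <-] := integrable_below t; rewrite mean_ge0 /=; last first.
  by move=> x; case/andP: (below_01 t x).
rewrite -mean1; apply: ler_mean => //; first by have [] := test_cst 1.
by move=> x; case/andP: (below_01 t x).
Qed.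

(** Chebyshev's inequality. *)
Let tails e : 0 < e -> exists2 M, 0 < M & F (- M) <= e /\ 1 - e <= F M.
Proof.
move=> e0; pose M := 1 + nu 2 / e.
have nu0 : 0 <= nu 2 by rewrite -mean_pow; apply: mean_ge0 => x; exact: sqr_ge0.
have nue : 0 <= nu 2 / e by rewrite divr_ge0// ltW.
have M0 : 0 < M by rewrite /M; lra.
have Me : M ^- 2 * nu 2 <= e.
  rewrite ler_pdivrMl ?exprn_gt0//.
  have -> : nu 2 = (nu 2 / e) * e by rewrite divfK// gt_eqF.
  rewrite ler_pM2r// /M; set z := nu 2 / e in nue *.
  by have := sqr_ge0 z; nra.
have far x : M <= `|x| -> 1 <= M ^- 2 * x ^+ 2.
  move=> xM; rewrite ler_pdivlMl ?exprn_gt0// mulr1 -(@real_normK _ x) ?num_real//.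
  by rewrite lerXn2r// nnegrE ltW.
have pos x : 0 <= M ^- 2 * x ^+ 2.
  by rewrite mulr_ge0 ?invr_ge0 ?sqr_ge0// exprn_ge0// ltW.
have i2 : integrable (fun x => M ^- 2 * x ^+ 2) by exact: integrableZ.
have m2 : mean (fun x => M ^- 2 * x ^+ 2) <= e by rewrite meanZ// mean_pow.
exists M => //; split.
  have [ib <-] := integrable_below (- M); apply: le_trans m2; apply: ler_mean => // x.
  rewrite /below; case: (leP x (- M)) => //= xM; apply: far.
  by have := ler_norm (- x); rewrite normrN; lra.
have [ib <-] := integrable_below M; rewrite lerBlDr.
apply: (le_trans _ (lerD (lexx _) m2)); rewrite -meanD// -mean1.
apply: ler_mean; [by have [] := test_cst 1|exact: integrableD|move=> x].
have := pos x; rewrite /below; case: (leP x M) => /= [_|xM _]; first by lra.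
by rewrite add0r; apply: far; have := ler_norm x; lra.
Qed.

(** Both distribution functions are monotone, and that of [P] varies by at most
    [e / 4] between neighbours on a grid of step [d]; so pointwise convergence at
    the finitely many points of the grid between [- M] and [M], outside of which
    the tails are small, is uniform. *)
Lemma moment_method e : 0 < e -> \forall k \near \oo,
  forall t, `|k%:R^-1 * \sum_(1 <= i < k.+1) (X i <= t)%R%:R
              - fine (P `]-oo, t]%classic)| <= e.
Proof.
move=> e0; have Kge0 := K_ge0; have e4 : 0 < e / 4 by lra.
have [M M0 [FM1 FM2]] := tails e4.
pose d := e / (4 * (K + 1)).
have d0 : 0 < d by rewrite divr_gt0// mulr_gt0//; lra.
have Kd : K * d <= e / 4.
  have K1 : K + 1 != 0 by apply: lt0r_neq0; lra.
  have -> : e / 4 = (K + 1) * d by rewrite /d; field.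
  by rewrite ler_pM2r//; lra.
pose p j : R := - M + j%:R * d.
pose N := (Num.truncn (2 * M / d)).+1.
have MN : M <= p N.
  have : 2 * M / d < N%:R by exact: truncnS_gt.
  by rewrite ltr_pdivrMr// /p; lra.
have grid n : \forall k \near \oo, forall j, (j < n)%N ->
    `|avg (below (p j)) k - F (p j)| <= e / 4.
  elim: n => [|n IHn]; first by apply: nearW.
  have /cvgrPdist_le/(_ _ e4) := @cvg_below (p n).
  apply: filterS2 IHn => k kn hn j; rewrite ltnS leq_eqVlt => /predU1P[->|/kn//].
  by rewrite distrC.
apply: filterS (grid N.+1) => k gk t.
rewrite -/(F t) -[_ * _]/(avg (below t) k).
have avg_le s s' : s <= s' -> avg (below s) k <= avg (below s') k.
  by move=> ss'; apply: ler_avg => x; exact: below_le.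
have F_le s s' : s <= s' -> F s <= F s' by move=> /F_lip /andP[].
have a0 : 0 <= avg (below t) k.
  by apply: avg_ge0 => x; case/andP: (below_01 t x).
have a1 : avg (below t) k <= 1.
  apply: (@le_trans _ _ (avg (fun=> 1) k)).
    by apply: ler_avg => x; case/andP: (below_01 t x).
  rewrite /avg sumr_const_nat subn1 /=; case: (k) => [|k'].
    by rewrite mulr0n mulr0.
  by rewrite mulVf ?pnatr_eq0.
have /andP[f0 f1] := F_01 t.
have [tM|Mt] := ltP t (- M).
  have p0 : p 0%N = - M by rewrite /p mul0r addr0.
  have := gk 0%N isT; rewrite p0 ler_norml.
  have := avg_le _ _ (ltW tM); have := F_le _ _ (ltW tM).
  by rewrite ler_norml; lra.
have [Nt|tN] := leP (p N) t.
  have := gk N (ltnSn N); rewrite ler_norml.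
  have := avg_le _ _ Nt; have := F_le _ _ Nt; have := F_le _ _ MN.
  by rewrite ler_norml; lra.
pose j := Num.truncn ((t + M) / d).
have tM0 : 0 <= (t + M) / d by rewrite divr_ge0 ?(ltW d0)//; lra.
have /andP[jt tj] := truncn_itv tM0.
have {}jt : p j <= t by move: jt; rewrite ler_pdivlMr// /p -/j; lra.
have {}tj : t <= p j.+1 by move: tj; rewrite ltr_pdivrMr// /p -/j; lra.
have jN : (j < N)%N.
  rewrite -(ltr_nat R) -(ltr_pM2r d0); move: jt tN; rewrite /p; lra.
have := gk j (ltnW jN); have := gk j.+1 jN; rewrite !ler_norml.
have := avg_le _ _ jt; have := avg_le _ _ tj.
have := F_le _ _ jt; have := F_le _ _ tj.
have : F (p j.+1) <= F (p j) + K * d.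
  have pp : p j.+1 - p j = d by rewrite /p -(natr1 j); ring.
  have : p j <= p j.+1 by rewrite -subr_ge0 pp ltW.
  by move=> /F_lip; rewrite pp => /andP[].
lra.
Qed.

End moment_method.

(** * Convergence of the empirical distributions *)

Lemma normal_moment_even n : (normal_moment (2 * n) * (2 ^ n * n`!) = (2 * n)`!)%N.
Proof.
elim: n => [//|n IHn].
rewrite mulnS !addSn add0n normal_momentS /= !factS -IHn expnS.
by rewrite -[(2 * n).+2]/(2 + 2 * n)%N -mulnS; ring.
Qed.

(** By [normal_moment_even] these are the terms of the exponential series at
    [a^2 / 2]. *)
Lemma cvg_normal_moment_growth (R : realType) (a : R) :
  a ^+ (2 * n) * (normal_moment (2 * n))%:R / (2 * n)`!%:R @[n --> \oo] --> (0 : R).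
Proof.
have := cvg_series_cvg_0 (is_cvg_series_exp_coeff (a ^+ 2 / 2)).
apply: cvg_trans; apply: near_eq_cvg; apply: nearW => n.
rewrite /exp_coeff /= -normal_moment_even !natrM natrX exprMn exprVn exprM.
have m0 : (normal_moment (2 * n))%:R != 0 :> R.
  rewrite pnatr_eq0; apply/eqP => m0; have := normal_moment_even n.
  by rewrite m0 mul0n => /esym/eqP; rewrite eqn0Ngt fact_gt0.
by field; rewrite m0 expf_neq0//= pnatr_eq0 -lt0n fact_gt0.
Qed.

Lemma empirical_cdf_sum (R : realType) (s : nat -> R) k t :
  empirical_cdf s k t = k%:R^-1 * \sum_(1 <= i < k.+1) (s i <= t)%R%:R.
Proof.
rewrite /empirical_cdf -sum1_card natr_sum big_add1 /= big_mkord; congr (_ * _).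
by rewrite big_mkcond; apply: eq_bigr => i _; rewrite unfold_in /=; case: ifP.
Qed.

Unset Implicit Arguments.
Set Strict Implicit.
Set Printing Implicit Defensive.

Theorem theorem3p5 (R : realType) (omega : cantor) :
  martin_lof_random R omega ->
  let X := block_sum R omega in
  (forall m : nat,
    [/\ forall k : nat, (1 <= k)%N ->
          ('E_(empirical X k)[fun x : R => (x ^+ m)%R]
           = (k%:R^-1 * \sum_(1 <= i < k.+1) X i ^+ m)%:E)%E,
        k%:R^-1 * (\sum_(1 <= i < k.+1) X i ^+ m)
          @[k --> \oo] --> ((normal_moment m)%:R : R)
      & ('E_(normal_prob (0 : R) 1)[fun x : R => (x ^+ m)%R]
         = ((normal_moment m)%:R)%:E)%E]) /\
  ereal_sup [set (`|empirical_cdf X k t - normal_cdf t|)%:E | t in [set: R]]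
    @[k --> \oo] --> 0%E.
Proof.
move=> random_omega X.
have X_moment m := @random_moment_average R omega m random_omega.
split=> [m|].
  split=> [k k0||]; last exact: expectation_pow_normal_prob.
  - by rewrite expectation_empirical//; exact: exprn_measurable.
  - exact: X_moment.
have mean_pow m : \int[normal_prob (0 : R) 1]_x (x ^+ m) = (normal_moment m)%:R.
  have := @expectation_pow_normal_prob R m; rewrite unlock /Rintegral => ->.
  by [].
have cdf_cvg := @moment_method R (normal_prob 0 1) X _
  (@integrable_pow_normal_prob R) mean_pow X_moment
  (@cvg_normal_moment_growth R) _ (@normal_cdf_lipschitz R).
have sup_ge0 k : (0 <= ereal_sup
    [set (`|empirical_cdf X k t - normal_cdf t|)%:E | t in [set: R]])%E.
  apply: (@le_trans _ _ (`|empirical_cdf X k 0 - normal_cdf 0|)%:E).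
    by rewrite lee_fin.
  by apply: ereal_sup_ubound; exists 0.
have sup_le e : 0 < e -> \forall k \near \oo,
    (ereal_sup [set (`|empirical_cdf X k t - normal_cdf t|)%:E | t in [set: R]]
       <= e%:E)%E.
  move=> e0; apply: filterS (cdf_cvg e e0) => k ke.
  apply: ge_ereal_sup => _ [t _ <-]; rewrite lee_fin empirical_cdf_sum.
  exact: ke.
apply: cvg_EFin.
  apply: filterS (sup_le 1 ltr01) => k k1.
  by rewrite ge0_fin_numE// (le_lt_trans k1)// ltry.
apply/cvgr0Pnorm_le => e e0; apply: filterS (sup_le e e0) => k ke.
rewrite /= ger0_norm ?fine_ge0// -lee_fin fineK//.
by rewrite ge0_fin_numE// (le_lt_trans ke)// ltry.
Qed.
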